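(* Let $(M,g)$ be a connected, oriented and time-oriented spin Lorentzian three-manifold (signature $(2,1)$), let $l\in\{\pm1\}$, let $\theta\in\Omega^1(M)$ and $\chi\in\Gamma(T^{\ast}M\otimes T^{\ast}M)$, and set $\mathfrak{a}=\frac12(\theta+\chi)\in\Omega^1(M,\wedge^{<}T^{\ast}M)$. Then $(M,g)$ admits a (not identically zero) differential spinor relative to a paired spinor bundle $(S,\Gamma,\mathcal{B})$ of type $l$ and an endomorphism-valued one-form $\mathcal{A}\in\Omega^1(M,\mathrm{End}(S))$ with dequantization $\mathfrak{a}$ if and only if it admits a nowhere vanishing isotropic one-form $u\in\Omega^1(M)$ satisfying $$\mathcal{D}^{g,\chi}u=\theta\otimes u,$$ where $\mathcal{D}^{g,\chi}$ is the unique metric connection on $(M,g)$ with contorsion tensor $$A^g_{w_1}(w_2)=l\ast_g(\chi_{w_1}\wedge w_2),\qquad w_1,w_2\in\mathfrak{X}(M).$$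
   Context: Vectors and one-forms are identified via $g$. A metric connection $\nabla$ has contorsion $A^g$ if $\nabla_{w_1}w_2=\nabla^g_{w_1}w_2+A^g_{w_1}(w_2)$, with $\nabla^g$ the Levi-Civita connection. $\chi_w$ denotes the one-form obtained by evaluating the first entry of $\chi$ on $w$. The Hodge star satisfies $\alpha\wedge\ast_g\beta=g(\alpha,\beta)\nu_g$, with $\nu_g$ the volume form. The Clifford algebra convention is $v^2=g^{\ast}(v,v)$. A paired spinor bundle of type $l$ is a triple $(S,\Gamma,\mathcal{B})$ where $S$ is a rank-two real vector bundle, $\Gamma:\mathrm{Cl}(T^{\ast}M,g^{\ast})\to\mathrm{End}(S)$ is a bundle of irreducible Clifford modules with $\Gamma(\nu_g)=l\,\mathrm{Id}$, and $\mathcal{B}$ is a fibrewise non-degenerate skew-symmetric bilinear pairing with $\mathcal{B}(\Gamma(v)\xi_1,\xi_2)=-\mathcal{B}(\xi_1,\Gamma(v)\xi_2)$ for all one-forms $v$. Such $S$ is associated to a spin structure, so $\nabla^g$ lifts to $S$. Here $\wedge^{<}T^{\ast}M=\mathbb{R}\oplus T^{\ast}M$, and $\Psi^{<}_{\Gamma}:\mathbb{R}\oplus T^{\ast}M\to\mathrm{End}(S)$, $c+\alpha\mapsto c\,\mathrm{Id}+\Gamma(\alpha)$, is an isomorphism of vector bundles. The dequantization of $\mathcal{A}\in\Omega^1(M,\mathrm{End}(S))$ is $\mathfrak{a}_w=(\Psi^{<}_{\Gamma})^{-1}(\mathcal{A}_w)$; thus dequantization $\frac12(\theta+\chi)$ means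 $\mathcal{A}_w=\frac12(\theta(w)\mathrm{Id}+\Gamma(\chi_w))$. A differential spinor relative to $(S,\Gamma,\mathcal{B})$ and $\mathcal{A}$ is a section $\varepsilon\in\Gamma(S)$ with $\nabla^g\varepsilon=\mathcal{A}(\varepsilon)$. The spinor bundle is part of what is asserted to exist. *)

(* Defs.v *)
From HB Require Import structures.
From mathcomp Require Import all_boot all_order all_algebra.
From mathcomp Require Import all_classical all_reals all_analysis.

Set Implicit Arguments.
Unset Strict Implicit.
Unset Printing Implicit Defensive.

Import Order.TTheory GRing.Theory Num.Theory.
Import numFieldNormedType.Exports.

Local Open Scope classical_set_scope.
Local Open Scope ring_scope.

Section EuclideanSmoothness.
Variable R : realType.

Fixpoint C_k (k : nat) (U : set 'rV[R]_3) (f : 'rV[R]_3 -> R) : Prop :=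
  match k with
  | 0 => forall x, U x -> {for x, continuous f}
  | k'.+1 => (forall x, U x -> differentiable (f : 'rV[R]_3 -> R^o) x) /\
             (forall i : 'I_3, C_k k' U
                (fun x => 'D_(delta_mx 0 i) (f : 'rV[R]_3 -> R^o) x))
  end.

Definition C_infty (U : set 'rV[R]_3) (f : 'rV[R]_3 -> R) : Prop :=
  forall k, C_k k U f.

End EuclideanSmoothness.

(* [chart_map c] and [chart_inv c] are only meaningful on [chart_dom c] and on
   its image.  [chart_at p] is a chosen chart around [p], used to represent
   the tangent space at [p]. *)
Record smooth_atlas (R : realType) (M : topologicalType) := SmoothAtlas {
  chart : Type;
  chart_dom : chart -> set M;
  chart_map : chart -> M -> 'rV[R]_3;
  chart_inv : chart -> 'rV[R]_3 -> M;
  chart_at : M -> chart;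
  open_chart_dom : forall c, open (chart_dom c);
  open_chart_img : forall c, open (chart_map c @` chart_dom c);
  chart_mapK : forall c p, chart_dom c p -> chart_inv c (chart_map c p) = p;
  continuous_chart_map : forall c p, chart_dom c p ->
    {for p, continuous (chart_map c)};
  continuous_chart_inv : forall c x, (chart_map c @` chart_dom c) x ->
    {for x, continuous (chart_inv c)};
  chart_at_dom : forall p, chart_dom (chart_at p) p;
  chart_transition : forall c d (i : 'I_3),
    C_infty (chart_map c @` (chart_dom c `&` chart_dom d))
            (fun x => chart_map d (chart_inv c x) 0 i)
}.

Section Manifold.
Variables (R : realType) (M : topologicalType) (at_ : smooth_atlas R M).

Definition smooth_fun (U : set M) (f : M -> R) : Prop :=
  forall c : chart at_, C_infty (chart_map c @` (U `&` chart_dom c))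
                    (f \o chart_inv c).

(* The tangent space at [p] is ['rV[R]_3]: a tangent vector is the row of its
   components in the chart [chart_at p].  The cotangent space is ['cV[R]_3]
   and the pairing of [v] with [a] is [(v *m a) 0 0]. *)
Notation tvec := 'rV[R]_3.
Notation covec := 'cV[R]_3.

Definition ev (a : covec) (v : tvec) : R := (v *m a) 0 0.

Definition mfd_diff (f : M -> R) (p : M) (v : tvec) : R :=
  'D_v (f \o chart_inv (chart_at at_ p) : tvec -> R^o)
       (chart_map (chart_at at_ p) p).

(* The [i]-th component of [X] in the chart [c] is [d(x_c^i)(X)]. *)
Definition smooth_vf (U : set M) (X : M -> tvec) : Prop :=
  forall (c : chart at_) (i : 'I_3), smooth_fun (U `&` chart_dom c)
    (fun p => mfd_diff (fun q => chart_map c q 0 i) p (X p)).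

(* Smoothness of covariant tensors is tested on local smooth vector fields. *)
Definition smooth_form (U : set M) (a : M -> covec) : Prop :=
  forall (V : set M) (X : M -> tvec), open V -> smooth_vf V X ->
    smooth_fun (U `&` V) (fun p => ev (a p) (X p)).

(* A bilinear form on the tangent space is given by its matrix. *)
Definition bil (b : 'M[R]_3) (v w : tvec) : R := (v *m b *m w^T) 0 0.

Definition smooth_bilinear (b : M -> 'M[R]_3) : Prop :=
  forall (V : set M) (X Y : M -> tvec), open V ->
    smooth_vf V X -> smooth_vf V Y -> smooth_fun V (fun p => bil (b p) (X p) (Y p)).

(* A connection on the bundle with fibres [F], whose sections smooth on an
   open set [U] are those satisfying [sm U], is a family of covariant
   derivatives at points.  It acts on sections smooth near the point (a section
   is total, but arbitrary away from [U]), which amounts to a connection on the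
   sheaf of smooth sections: locality follows from the Leibniz rule, applied
   with a function constant near the point. *)
Definition is_connection (F : M -> lmodType R)
    (sm : set M -> (forall p, F p) -> Prop)
    (D : forall p : M, tvec -> (forall q, F q) -> F p) : Prop :=
  [/\ forall U p s (k : R) v w, open U -> U p -> sm U s ->
        D p (k *: v + w) s = k *: D p v s + D p w s,
      forall U p s t v, open U -> U p -> sm U s -> sm U t ->
        D p v (fun q => s q + t q) = D p v s + D p v t,
      forall U p f s v, open U -> U p -> smooth_fun U f -> sm U s ->
        D p v (fun q => f q *: s q) = mfd_diff f p v *: s p + f p *: D p v s &
      forall U X s, open U -> smooth_vf U X -> sm U s ->
        sm U (fun p => D p (X p) s)].

Definition tangent_cov := forall p : M, tvec -> (M -> tvec) -> tvec.

Definition metric_connection (g : M -> 'M[R]_3) (D : tangent_cov) : Prop :=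
  is_connection (F := fun _ => tvec) smooth_vf D /\
  forall U p X Y v, open U -> U p -> smooth_vf U X -> smooth_vf U Y ->
    mfd_diff (fun q => bil (g q) (X q) (Y q)) p v =
    bil (g p) (D p v X) (Y p) + bil (g p) (X p) (D p v Y).

(* [D_X Y - D_Y X = [X, Y]], the bracket being the commutator of derivations. *)
Definition torsion_free (D : tangent_cov) : Prop :=
  forall U p X Y f, open U -> U p -> smooth_vf U X -> smooth_vf U Y ->
    smooth_fun U f ->
    mfd_diff f p (D p (X p) Y - D p (Y p) X) =
    mfd_diff (fun q => mfd_diff f q (Y q)) p (X p) -
    mfd_diff (fun q => mfd_diff f q (X q)) p (Y p).

Definition levi_civita (g : M -> 'M[R]_3) (D : tangent_cov) : Prop :=
  metric_connection g D /\ torsion_free D.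

Definition has_contorsion (nablag D : tangent_cov) (A : M -> tvec -> tvec -> tvec) :=
  forall U p w Y, open U -> U p -> smooth_vf U Y ->
    D p w Y = nablag p w Y + A p w (Y p).

(* [D u = theta (x) u] for the connection induced by [D] on one-forms,
   [(D_w u)(Y) = w(u(Y)) - u(D_w Y)]. *)
Definition recurrent_form (D : tangent_cov) (theta u : M -> covec) : Prop :=
  forall U p w Y, open U -> U p -> smooth_vf U Y ->
    mfd_diff (fun q => ev (u q) (Y q)) p w - ev (u p) (D p w Y) =
    ev (theta p) w * ev (u p) (Y p).

Definition lorentz_gram : 'M[R]_3 :=
  diag_mx (\row_(i < 3) (if i == 2 then -1 else 1)).

Definition lorentzian (g : M -> 'M[R]_3) : Prop :=
  smooth_bilinear g /\
  forall p, (g p)^T = g p /\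
    exists2 E : 'M[R]_3, E \in unitmx & E *m g p *m E^T = lorentz_gram.

Definition cometric (G : 'M[R]_3) (a b : covec) : R := (a^T *m invmx G *m b) 0 0.
Definition flat (G : 'M[R]_3) (v : tvec) : covec := G *m v^T.
Definition sharp (G : 'M[R]_3) (a : covec) : tvec := (invmx G *m a)^T.

(* An orientation of the tangent space at [p] is encoded by a sign [o p]; a
   basis, given by the rows of [V], is positive when [positive (o p) V].  The
   same convention applies to bases of the cotangent space, given by columns. *)
Definition positive (s : bool) (V : 'M[R]_3) : Prop := 0 < (-1) ^+ s * \det V.

Definition orientation (o : M -> bool) : Prop :=
  forall p, exists (U : set M) (V : M -> 'M[R]_3),
    [/\ open U, U p, forall i, smooth_vf U (fun q => row i (V q)) &
        forall q, U q -> positive (o q) (V q)].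

(* A time orientation is represented by a global timelike vector field. *)
Definition time_orientation (g : M -> 'M[R]_3) (T : M -> tvec) : Prop :=
  smooth_vf setT T /\ forall p, bil (g p) (T p) (T p) < 0.

(* The arguments of the volume form are the rows of [V]. *)
Definition volume_form (G : 'M[R]_3) (s : bool) (V : 'M[R]_3) : R :=
  (-1) ^+ s * Num.sqrt `|\det G| * \det V.

(* Two-forms on a tangent space are skew matrices. *)
Definition twoform (W : 'M[R]_3) : Prop := W^T = - W.

Definition wedge11 (a b : covec) : 'M[R]_3 := a *m b^T - b *m a^T.

Definition wedge21 (W : 'M[R]_3) (a : covec) (V : 'M[R]_3) : R :=
  bil W (row 0 V) (row 1 V) * ev a (row 2 V) +
  bil W (row 1 V) (row 2 V) * ev a (row 0 V) +
  bil W (row 2 V) (row 0 V) * ev a (row 1 V).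

(* [1/2 W_ij W'_kl g^ik g^jl], so that the product of [a1 /\ a2] and
   [b1 /\ b2] is the determinant of the [g(ai, bj)] *)
Definition twoform_metric (G W W' : 'M[R]_3) : R :=
  2^-1 * \tr (W^T *m invmx G *m W' *m invmx G).

Definition hodge_star2 (G : 'M[R]_3) (s : bool) (W : 'M[R]_3) : covec :=
  xget 0 [set a : covec | forall W', twoform W' -> forall V,
            wedge21 W' a V = twoform_metric G W' W * volume_form G s V].

(* [chi_w = chi(w, .)] *)
Definition first_entry (chi : M -> 'M[R]_3) (p : M) (w : tvec) : covec :=
  (w *m chi p)^T.

Definition contorsion (g : M -> 'M[R]_3) (o : M -> bool) (l : R)
    (chi : M -> 'M[R]_3) (p : M) (w1 w2 : tvec) : tvec :=
  sharp (g p) (l *: hodge_star2 (g p) (o p)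
    (wedge11 (first_entry chi p w1) (flat (g p) w2))).

(* Spin_0(2,1) is SL(2,R): it acts by conjugation on the traceless matrices,
   identified with R^{2,1} by [minkowski_sl2], which satisfies
   [minkowski_sl2 x ^+ 2 = bil lorentz_gram x x]. *)
Definition minkowski_sl2 (x : 'rV[R]_3) : 'M[R]_2 :=
  \matrix_(i < 2, j < 2)
    (if i == 0 then (if j == 0 then x 0 0 else x 0 1 + x 0 2)
     else (if j == 0 then x 0 1 - x 0 2 else - x 0 0)).

(* An oriented, time-oriented orthonormal frame, given by the rows of [E] *)
Definition adapted_frame (g : M -> 'M[R]_3) (o : M -> bool) (T : M -> tvec)
    (p : M) (E : 'M[R]_3) : Prop :=
  [/\ E *m g p *m E^T = lorentz_gram, positive (o p) E &
      bil (g p) (row 2 E) (T p) < 0].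

(* A spin structure as a lift to SL(2,R) of the transition functions of the
   bundle of adapted frames: [h a b] maps components in the frame [e b] to
   components in the frame [e a]. *)
Definition spin_manifold (g : M -> 'M[R]_3) (o : M -> bool) (T : M -> tvec) : Prop :=
  exists (I : Type) (dom : I -> set M) (e : I -> M -> 'M[R]_3)
         (h : I -> I -> M -> 'M[R]_2),
  [/\ (forall a, open (dom a)) /\ (forall p, exists a, dom a p),
      forall a, (forall i, smooth_vf (dom a) (fun p => row i (e a p))) /\
                (forall p, dom a p -> adapted_frame g o T p (e a p)),
      forall a b, (forall i j, smooth_fun (dom a `&` dom b) (fun p => h a b p i j)) /\
                  (forall p, dom a p -> dom b p -> \det (h a b p) = 1),
      forall a b p (x y : 'rV[R]_3), dom a p -> dom b p ->
        x *m e b p = y *m e a p ->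
        minkowski_sl2 y = h a b p *m minkowski_sl2 x *m invmx (h a b p) &
      forall a b c p, dom a p -> dom b p -> dom c p ->
        h a b p *m h b c p = h a c p].

(* A smooth real vector bundle of rank [r], given by its fibres and by local
   frames with smooth transition functions *)
Record vector_bundle (r : nat) := VectorBundle {
  fib :> M -> vectType R;
  triv : Type;
  triv_dom : triv -> set M;
  frame : triv -> forall p, r.-tuple (fib p);
  open_triv_dom : forall a, open (triv_dom a);
  triv_cover : forall p, exists a, triv_dom a p;
  frame_basis : forall a p, triv_dom a p -> basis_of fullv (frame a p);
  frame_transition : forall a b (i j : 'I_r),
    smooth_fun (triv_dom a `&` triv_dom b)
               (fun p => coord (frame a p) i (tnth (frame b p) j))
}.

Section SpinorBundle.
Variable S : vector_bundle 2.

Definition smooth_sec (U : set M) (s : forall p, S p) : Prop :=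
  forall (a : triv S) (i : 'I_2), smooth_fun (U `&` triv_dom a)
                         (fun p => coord (frame a p) i (s p)).

(* The bundle map [Cl(T*M, g* ) -> End(S)] is given by its restriction [Gam] to
   the generators.  The Clifford element [nu_g] is [e^1 e^2 e^3] for any
   positive orthonormal coframe, the columns of [E]. *)
Definition irreducible_clifford (g : M -> 'M[R]_3) (o : M -> bool) (l : R)
    (Gam : forall p, covec -> 'End(S p)) : Prop :=
  [/\ forall p (k : R) a b, Gam p (k *: a + b) = k *: Gam p a + Gam p b,
      forall U a s, open U -> smooth_form U a -> smooth_sec U s ->
        smooth_sec U (fun p => Gam p (a p) (s p)),
      forall p a, (Gam p a \o Gam p a)%VF = cometric (g p) a a *: \1%VF,
      forall p (V : {vspace S p}), (forall a, (Gam p a @: V <= V)%VS) ->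
        V = 0%VS \/ V = fullv &
      forall p (E : 'M[R]_3), E^T *m invmx (g p) *m E = lorentz_gram ->
        positive (o p) E ->
        (Gam p (col 0 E) \o Gam p (col 1 E) \o Gam p (col 2 E))%VF = l *: \1%VF].

Definition spinor_pairing (Gam : forall p, covec -> 'End(S p))
    (B : forall p, S p -> S p -> R) : Prop :=
  [/\ forall p (k : R) x y z, B p (k *: x + y) z = k * B p x z + B p y z,
      forall p x y, B p x y = - B p y x,
      forall p x, (forall y, B p x y = 0) -> x = 0,
      forall U s t, open U -> smooth_sec U s -> smooth_sec U t ->
        smooth_fun U (fun p => B p (s p) (t p)) &
      forall p a x y, B p (Gam p a x) y = - B p x (Gam p a y)].

Definition paired_spinor_bundle (g : M -> 'M[R]_3) (o : M -> bool) (l : R)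
    (Gam : forall p, covec -> 'End(S p)) (B : forall p, S p -> S p -> R) : Prop :=
  irreducible_clifford g o l Gam /\ spinor_pairing Gam B.

Definition spinor_cov := forall p : M, tvec -> (forall q, S q) -> S p.

(* The lift of the connection [nablag] of the tangent bundle to [S]: the
   frames of [S] in which [Gam] and [B] are constant are the local sections of
   the SL(2,R)-bundle to which [S] is associated, and the induced connection is
   the one making [Gam] and [B] parallel. *)
Definition spin_lift (g : M -> 'M[R]_3) (nablag : tangent_cov)
    (Gam : forall p, covec -> 'End(S p)) (B : forall p, S p -> S p -> R)
    (nabla : spinor_cov) : Prop :=
  [/\ is_connection (F := fun p => S p) smooth_sec nabla,
      forall U p X s v, open U -> U p -> smooth_vf U X -> smooth_sec U s ->
        nabla p v (fun q => Gam q (flat (g q) (X q)) (s q)) =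
        Gam p (flat (g p) (nablag p v X)) (s p) +
        Gam p (flat (g p) (X p)) (nabla p v s) &
      forall U p s t v, open U -> U p -> smooth_sec U s -> smooth_sec U t ->
        mfd_diff (fun q => B q (s q) (t q)) p v =
        B p (nabla p v s) (t p) + B p (s p) (nabla p v t)].

Definition endo_form (A : forall p, tvec -> 'End(S p)) : Prop :=
  (forall p (k : R) v w, A p (k *: v + w) = k *: A p v + A p w) /\
  (forall U X s, open U -> smooth_vf U X -> smooth_sec U s ->
     smooth_sec U (fun p => A p (X p) (s p))).

(* The dequantization of [A] is the preimage of [A w] under [quantization],
   an isomorphism from [R (+) T*M] to [End(S)] for a paired spinor bundle. *)
Definition quantization (Gam : forall p, covec -> 'End(S p)) (p : M)
    (x : R * covec) : 'End(S p) := x.1 *: \1%VF + Gam p x.2.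

Definition has_dequantization (Gam : forall p, covec -> 'End(S p))
    (A : forall p, tvec -> 'End(S p)) (a : M -> tvec -> R * covec) : Prop :=
  forall p w, quantization Gam p (a p w) = A p w.

Definition differential_spinor (nabla : spinor_cov)
    (A : forall p, tvec -> 'End(S p)) (eps : forall p, S p) : Prop :=
  smooth_sec setT eps /\ forall p w, nabla p w eps = A p w (eps p).

End SpinorBundle.

Definition half_sum (theta : M -> covec) (chi : M -> 'M[R]_3) (p : M) (w : tvec) :
    R * covec :=
  (2^-1 * ev (theta p) w, 2^-1 *: first_entry chi p w).

End Manifold.

(* Main.v *)
(* If [eps] is a differential spinor then it is parallel for [nablaS - A]: its
   coordinates solve a linear system along lines in charts, so that [eps] vanishes
   nowhere on a connected manifold.  Its square [u(v) = B(Gamma(v^b) eps, eps)] is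
   isotropic, and [Gamma(a) Gamma(b) = g(a, b) - l Gamma( *(a /\ b))] turns
   [nabla eps = A eps] into the recurrence of [u].

   Conversely, let [U] be the dual of an isotropic [u].  As [T] is timelike,
   [g(T, U)] has no zero, and [T], [U] and the orientation yield a global frame
   [(K, U, n)] with [K], [U] null, [g(K, U) = g(n, n) = 1] and [n] dual to
   [vol(K, U, .)].  The spinor bundle sought is then trivial, with frame
   [(eps, Gamma(K^b) eps)] and [Gamma(U^b) eps = 0]: Clifford multiplication, the
   pairing and the lift of the Levi-Civita connection have explicit matrices in
   this frame.  The first row of the connection matrix only involves
   [g(nabla K, U)] and [g(nabla U, n)], and the recurrence of [u] determines both:
   it says exactly that [nabla eps = A eps].  The given spin structure only serves
   to provide local smooth orthonormal frames. *)

Require Import Defs.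
From mathcomp Require Import all_boot all_order all_algebra.
From mathcomp Require Import all_classical all_reals all_analysis.
From mathcomp Require Import ring lra.
Import Order.TTheory GRing.Theory Num.Theory.
Import numFieldNormedType.Exports.
Local Open Scope classical_set_scope.
Local Open Scope ring_scope.

Set Implicit Arguments.
Unset Strict Implicit.
Unset Printing Implicit Defensive.

(** One matrix model serves both implications: a one-form acts on spinor coordinates by
    [clifford_mx], whose entries are its values on a null frame. The factor in [2 * ev a K] comes
    from the Clifford relation [Gamma(U^b) Gamma(K^b) + Gamma(K^b) Gamma(U^b) = 2]. In one direction
    the null frame is built from [u]; in the other, every fibre of an arbitrary paired spinor bundle
    takes this form in any basis, so that the product formula is verified on matrices only. The
    obstacle is smoothness: the components of a tangent vector refer to the chart chosen at its base
    point, and this choice may jump. Components, the determinant of the metric and the sign [o] are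
    therefore never treated as functions of the point; only scalars such as [g(X, Y)] or [u(X)] are,
    often with members of a local orthonormal frame. The recurrence says nothing about
    [g(nabla K, n)], but this coefficient multiplies the second coordinate of the spinor, which is
    zero for the one constructed. The square of that spinor is [- u]; the recurrence is linear in
    [u] and does not see the sign. *)

(** * Calculus of [C_k] functions on open sets of three-space *)

Section Calculus.
Variable R : realType.
Local Notation E := 'rV[R]_3.
Implicit Types (U V : set E) (f g : E -> R).

(** Being a differential is a condition on germs: the first-order expansion of [f] at [x] is also
    one of [g], so ['d f x] is the differential of [g] by uniqueness. *)
Lemma near_eq_differentiable (V W : normedModType R) (f g : V -> W) (x : V) :
  {near x, f =1 g} -> differentiable f x -> differentiable g x.
Proof.
move=> fg df; have fgx : f x = g x by exact: (nbhs_singleton fg).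
have dfc := diff_continuous df.
have H : g \o shift x = cst (g x) + 'd f x +o_ 0 id.
  apply/eqaddoP => e e0; have := diff_locally df; move/eqaddoP => /(_ e e0).
  have : \forall y \near (0:V), f (y + x) = g (y + x).
    by move: fg; rewrite (near_shift 0 x) /=; apply: filterS => y; rewrite /= subr0.
  by apply: filterS2 => y; rewrite /= -!fctE /= => E1; rewrite !fctE /= E1 fgx.
apply/diff_locallyP; suff -> : ('d g x : V -> W) = 'd f x by split.
by apply: diff_unique.
Qed.

Lemma open_near_eq (V : topologicalType) (W : Type) (U : set V) (f g : V -> W) x :
  open U -> U x -> (forall y, U y -> f y = g y) -> {near x, f =1 g}.
Proof. by move=> oU Ux fg; apply: filterS (open_nbhs_nbhs (conj oU Ux)). Qed.

(** All conditions in [C_k] are imposed at single points on derivatives of a total function, so they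
    can be checked point by point even when [U] is not open. Restriction to subsets and locality on
    the manifold both come from this. *)
Lemma C_k_pointwise k U f : C_k k U f <-> forall x, U x -> C_k k [set x] f.
Proof.
split.
- elim: k U f => [|k IH] U f /=; first by move=> H x Ux _ ->; exact: H.
  move=> [H1 H2] x Ux; split; first by move=> _ ->; exact: H1.
  by move=> i; apply: IH (H2 i) _ Ux.
- elim: k U f => [|k IH] U f /= H; first by move=> x Ux; exact: (H x Ux).
  split; first by move=> x Ux; exact: (H x Ux).1.
  by move=> i; apply: IH => x Ux; exact: (H x Ux).2.
Qed.

Lemma C_k_sub k U V f : V `<=` U -> C_k k U f -> C_k k V f.
Proof.
by move=> VU /C_k_pointwise Hf; apply/C_k_pointwise => x Vx; apply/Hf/VU.
Qed.

Lemma C_kW k U f : C_k k.+1 U f -> C_k k U f.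
Proof.
elim: k f => [|k IH] f [H1 H2] /=.
  by move=> x Ux; exact: (differentiable_continuous (H1 x Ux)).
by split=> // i; apply: IH.
Qed.

(** On an open set, agreement of [f] and [g] is agreement near each point, hence passes to the
    derivatives. *)
Lemma C_k_eq k U f g : open U -> (forall x, U x -> f x = g x) ->
  C_k k U f -> C_k k U g.
Proof.
move=> oU; elim: k f g => [|k IH] f g fg /=.
  move=> H x Ux; have nfg := open_near_eq oU Ux fg.
  rewrite /prop_for /continuous_at -(fg x Ux).
  exact: cvg_trans (near_eq_cvg nfg) (H x Ux).
move=> [H1 H2]; split.
  by move=> x Ux; apply: near_eq_differentiable (open_near_eq oU Ux fg) (H1 x Ux).
move=> i; apply: IH (H2 i) => x Ux.
exact: near_eq_derive (open_near_eq oU Ux fg).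
Qed.

Lemma C_k_cst k U (c : R) : C_k k U (cst c).
Proof.
elim: k c => [|k IH] c /=; first by move=> x _; exact: cst_continuous.
split=> [x _|i]; first exact: differentiable_cst.
rewrite (_ : (fun x => _) = cst 0) //.
by apply/funext => x; rewrite derive_cst.
Qed.

Lemma C_k_add k U f g : open U -> C_k k U f -> C_k k U g ->
  C_k k U (fun x => f x + g x).
Proof.
move=> oU; elim: k f g => [|k IH] f g /=.
  by move=> Hf Hg x Ux; exact: (cvgD (Hf x Ux) (Hg x Ux)).
move=> [f1 f2] [g1 g2]; split=> [x Ux|i].
  by apply: differentiableD; [exact: f1|exact: g1].
apply: C_k_eq (IH _ _ (f2 i) (g2 i)) => // x Ux.
rewrite [RHS](@deriveD _ _ _ (f : E -> R^o) g) //; apply: diff_derivable; auto.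
Qed.

Lemma C_k_mul k U f g : open U -> C_k k U f -> C_k k U g ->
  C_k k U (fun x => f x * g x).
Proof.
move=> oU; elim: k f g => [|k IH] f g.
  by move=> Hf Hg x Ux; exact: (cvgM (Hf x Ux) (Hg x Ux)).
move=> Hf Hg; have fW := C_kW Hf; have gW := C_kW Hg.
case: Hf Hg => f1 f2 [g1 g2]; split=> [x Ux|i].
  by apply: differentiableM; [exact: f1|exact: g1].
apply: C_k_eq (C_k_add oU (IH _ _ fW (g2 i)) (IH _ _ gW (f2 i))) => // x Ux.
by rewrite [RHS](@deriveM _ _ (f : E -> R^o) g) //; apply: diff_derivable; auto.
Qed.

Lemma C_k_inv k U f : open U -> (forall x, U x -> f x != 0) -> C_k k U f ->
  C_k k U (fun x => (f x)^-1).
Proof.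
move=> oU f0; elim: k f f0 => [|k IH] f f0.
  by move=> Hf x Ux; exact: (cvgV (f0 x Ux) (Hf x Ux)).
move=> Hf; have fW := C_kW Hf; case: Hf => f1 f2; split=> [x Ux|i].
  by apply: differentiableV; [exact: f1|exact: f0].
have Hi := IH _ f0 fW.
have := C_k_mul oU (C_k_cst k U (-1)) (C_k_mul oU (C_k_mul oU Hi Hi) (f2 i)).
apply: C_k_eq => // x Ux.
rewrite [RHS](@deriveV _ _ (f : E -> R^o)) ?f0 //.
  by rewrite mulN1r scaleNr -exprVn expr2.
by apply: diff_derivable; exact: f1.
Qed.

Lemma C_infty_diff U f x : C_infty U f -> U x -> differentiable (f : E -> R^o) x.
Proof. by move=> /(_ 1%N) [H _]; apply: H. Qed.

Lemma C_infty_derive U f i : C_infty U f ->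
  C_infty U (fun x => 'D_(delta_mx 0 i) (f : E -> R^o) x).
Proof. by move=> H k; have [_] := H k.+1; apply. Qed.

Lemma derive_partials f x v : differentiable (f : E -> R^o) x ->
  'D_v (f : E -> R^o) x = \sum_i v 0 i * 'D_(delta_mx 0 i) (f : E -> R^o) x.
Proof.
move=> df; rewrite deriveE // {1}(row_sum_delta v) linear_sum.
by apply: eq_bigr => i _; rewrite linearZ deriveE.
Qed.

Lemma differentiable_row (h : E -> E) x :
  (forall i, differentiable ((fun y => h y 0 i) : E -> R^o) x) ->
  differentiable h x.
Proof.
move=> H; rewrite (_ : h = \sum_(i < 3) (fun y => h y 0 i *: delta_mx 0 i)).
  by apply: differentiable_sum => i; apply: differentiableZl; exact: H.
by apply/funext => y; rewrite fct_sumE -row_sum_delta.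
Qed.

Lemma diff_row (h : E -> E) x v i :
  differentiable h x -> ('d h x v) 0 i = 'D_v ((fun y => h y 0 i) : E -> R^o) x.
Proof.
move=> dh; rewrite -deriveE // derive_mx; last exact: diff_derivable.
by rewrite mxE.
Qed.

Lemma derive_comp_partials f (h : E -> E) x v :
  differentiable h x -> differentiable (f : E -> R^o) (h x) ->
  'D_v (f \o h : E -> R^o) x =
  \sum_i 'D_(delta_mx 0 i) (f : E -> R^o) (h x) *
         'D_v ((fun y => h y 0 i) : E -> R^o) x.
Proof.
move=> dh df; rewrite deriveE; last exact: differentiable_comp.
rewrite diff_comp //= -deriveE // derive_partials //.
by apply: eq_bigr => i _; rewrite diff_row // mulrC.
Qed.

Lemma C_k_sum k U n (F : 'I_n -> E -> R) : open U ->
  (forall i, C_k k U (F i)) -> C_k k U (fun x => \sum_(i < n) F i x).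
Proof.
move=> oU HF; elim: n F HF => [|n IH] F HF.
  apply: C_k_eq oU _ (C_k_cst k U 0) => x _; by rewrite big_ord0.
apply: C_k_eq oU _ (C_k_add oU (IH _ (fun i => HF (widen_ord (leqnSn n) i)))
  (HF ord_max)) => x _.
by rewrite big_ord_recr.
Qed.

(** Induction on [k] through the chain rule: the partial derivatives of [f] fall under the induction
    hypothesis, those of [h] are [C_infty] outright. *)
Lemma C_k_comp k U V f (h : E -> E) : open U -> open V ->
  (forall x, U x -> V (h x)) -> (forall i, C_infty U (fun x => h x 0 i)) ->
  C_k k V f -> C_k k U (f \o h).
Proof.
move=> oU oV UV Hh.
have dh x : U x -> differentiable h x.
  by move=> Ux; apply: differentiable_row => i; exact: C_infty_diff (Hh i) Ux.
elim: k f => [|k IH] f.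
  move=> Hf x Ux; apply: continuous_comp; first exact/differentiable_continuous/dh.
  exact: Hf (UV _ Ux).
move=> [f1 f2]; split=> [x Ux|j].
  by apply: differentiable_comp; [exact: dh|exact: (f1 _ (UV _ Ux))].
apply: (@C_k_eq _ _ (fun x => \sum_(i < 3) ((fun y =>
   'D_(delta_mx 0 i) (f : E -> R^o) y) \o h) x *
   'D_(delta_mx 0 j) ((fun y => h y 0 i) : E -> R^o) x)) => //.
  move=> x Ux; rewrite derive_comp_partials //; first exact: dh.
  exact: (f1 _ (UV _ Ux)).
apply: C_k_sum => // i; apply: C_k_mul => //; first exact: IH _ (f2 i).
exact: (C_infty_derive j (Hh i)).
Qed.

End Calculus.

(** * Smooth functions, directional derivatives and vector fields on the manifold *)

Section ManifoldCalculus.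
Variables (R : realType) (M : topologicalType) (at_ : smooth_atlas R M).
Local Notation E := 'rV[R]_3.
Local Notation smooth_fun := (smooth_fun at_).
Local Notation smooth_vf := (smooth_vf at_).
Local Notation mfd_diff := (mfd_diff at_).
Implicit Types (U V W : set M) (f g : M -> R) (X Y : M -> E) (c d : chart at_).

(** Inside the open image of the chart, this set is the preimage of [U] under [chart_inv c], which
    is continuous there. *)
Lemma open_chart_imageI c U : open U -> open (chart_map c @` (U `&` chart_dom c)).
Proof.
move=> oU; rewrite openE => _ [p [Up cp] <-].
have ip : (chart_map c @` chart_dom c) (chart_map c p) by exists p.
have H1 : nbhs (chart_map c p) (chart_map c @` chart_dom c).
  by apply: open_nbhs_nbhs; split => //; exact: open_chart_img.
have H2 : nbhs (chart_map c p) (chart_inv c @^-1` U).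
  apply: (continuous_chart_inv ip); rewrite chart_mapK //.
  by apply: open_nbhs_nbhs; split.
apply: filterS2 H1 H2 => _ [q cq <-] /=; rewrite chart_mapK // => Uq.
by exists q.
Qed.

Arguments open_chart_imageI c [U] _.

Lemma smooth_fun_sub U V f : V `<=` U -> smooth_fun U f -> smooth_fun V f.
Proof.
move=> VU Hf c k; apply: C_k_sub (Hf c k) => _ [p [Vp cp] <-].
by exists p => //; split=> //; exact: VU.
Qed.

Lemma smooth_fun_local U f :
  (forall p, U p -> exists2 W, W p & smooth_fun W f) -> smooth_fun U f.
Proof.
move=> H c k; apply/C_k_pointwise => _ [p [Up cp] <-].
have [W Wp Hf] := H p Up; apply: C_k_sub (Hf c k) => _ ->.
by exists p.
Qed.

Lemma smooth_fun_eq U f g : open U -> (forall p, U p -> f p = g p) ->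
  smooth_fun U f -> smooth_fun U g.
Proof.
move=> oU fg Hf c k; apply: C_k_eq (Hf c k); first exact: open_chart_imageI.
by move=> _ [p [Up cp] <-] /=; rewrite chart_mapK //; exact: fg.
Qed.

Lemma smooth_fun_cst U (k : R) : smooth_fun U (fun=> k).
Proof. by move=> c n; exact: C_k_cst. Qed.

Lemma smooth_funD U f g : open U -> smooth_fun U f -> smooth_fun U g ->
  smooth_fun U (fun p => f p + g p).
Proof.
by move=> oU Hf Hg c k; exact: (C_k_add (open_chart_imageI c oU) (Hf c k) (Hg c k)).
Qed.

Lemma smooth_funM U f g : open U -> smooth_fun U f -> smooth_fun U g ->
  smooth_fun U (fun p => f p * g p).
Proof.
by move=> oU Hf Hg c k; apply: (C_k_mul (open_chart_imageI c oU) (Hf c k) (Hg c k)).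
Qed.

Lemma smooth_funN U f : open U -> smooth_fun U f -> smooth_fun U (fun p => - f p).
Proof.
move=> oU Hf; apply: smooth_fun_eq oU _ (smooth_funM oU (smooth_fun_cst U (-1)) Hf).
by move=> p _; rewrite mulN1r.
Qed.

Lemma smooth_funB U f g : open U -> smooth_fun U f -> smooth_fun U g ->
  smooth_fun U (fun p => f p - g p).
Proof. by move=> oU Hf Hg; apply: smooth_funD => //; exact: smooth_funN. Qed.

Lemma smooth_funV U f : open U -> (forall p, U p -> f p != 0) ->
  smooth_fun U f -> smooth_fun U (fun p => (f p)^-1).
Proof.
move=> oU f0 Hf c k; apply: (C_k_inv (open_chart_imageI c oU) _ (Hf c k)).
by move=> _ [p [Up cp] <-] /=; rewrite chart_mapK //; exact: f0.
Qed.

Lemma smooth_fun_diff c U f p : smooth_fun U f -> U p -> chart_dom c p ->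
  differentiable (f \o chart_inv c : E -> R^o) (chart_map c p).
Proof. by move=> Hf Up cp; apply: C_infty_diff (Hf c) _; exists p. Qed.

Lemma smooth_fun_continuous U f p : open U -> smooth_fun U f -> U p ->
  {for p, continuous f}.
Proof.
move=> oU Hf Up; have cp := chart_at_dom at_ p; set c := chart_at at_ p in cp.
have Hc : {for p, continuous ((f \o chart_inv c) \o chart_map c)}.
  apply: continuous_comp; first exact: continuous_chart_map.
  exact/differentiable_continuous/(smooth_fun_diff Hf).
have nE : {near p, (f \o chart_inv c) \o chart_map c =1 f}.
  apply: filterS (open_nbhs_nbhs (conj (open_chart_dom c) cp)) => q cq /=.
  by rewrite chart_mapK.
rewrite /prop_for /continuous_at -(nbhs_singleton nE).
exact: cvg_trans (near_eq_cvg nE) Hc.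
Qed.

Lemma smooth_chart_map c (i : 'I_3) :
  smooth_fun (chart_dom c) (fun q => chart_map c q 0 i).
Proof. by move=> d; rewrite setIC; exact: chart_transition. Qed.

Section DirectionalDerivative.
Variables (U : set M) (p : M).
Hypotheses (oU : open U) (Up : U p).
Let cp := chart_at_dom at_ p.

Lemma mfd_diff_linear f (k : R) v w : smooth_fun U f ->
  mfd_diff f p (k *: v + w) = k * mfd_diff f p v + mfd_diff f p w.
Proof.
move=> Hf; have df := smooth_fun_diff Hf Up cp.
by rewrite /mfd_diff !deriveE // linearP.
Qed.

Lemma mfd_diff_eq f g v : (forall q, U q -> f q = g q) ->
  mfd_diff f p v = mfd_diff g p v.
Proof.
move=> fg; apply: near_eq_derive.
apply: (open_near_eq (open_chart_imageI (chart_at at_ p) oU)); first by exists p.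
by move=> _ [q [Uq cq] <-] /=; rewrite chart_mapK //; exact: fg.
Qed.

Lemma mfd_diff_cst (k : R) v : mfd_diff (fun=> k) p v = 0.
Proof. exact: derive_cst. Qed.

Lemma mfd_diffD f g v : smooth_fun U f -> smooth_fun U g ->
  mfd_diff (fun q => f q + g q) p v = mfd_diff f p v + mfd_diff g p v.
Proof.
move=> Hf Hg; have df := smooth_fun_diff Hf Up cp.
have dg := smooth_fun_diff Hg Up cp.
by rewrite [LHS]deriveD //; apply: diff_derivable.
Qed.

Lemma mfd_diffM f g v : smooth_fun U f -> smooth_fun U g ->
  mfd_diff (fun q => f q * g q) p v = mfd_diff f p v * g p + f p * mfd_diff g p v.
Proof.
move=> Hf Hg; have df := smooth_fun_diff Hf Up cp.
have dg := smooth_fun_diff Hg Up cp.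
rewrite [LHS]deriveM //; [|exact: diff_derivable|exact: diff_derivable].
by rewrite /= chart_mapK // addrC; congr (_ + _); rewrite mulrC.
Qed.

Lemma mfd_diffMl (k : R) f v : smooth_fun U f ->
  mfd_diff (fun q => k * f q) p v = k * mfd_diff f p v.
Proof.
by move=> Hf; rewrite mfd_diffM ?mfd_diff_cst ?mul0r ?add0r //; exact: smooth_fun_cst.
Qed.

Lemma mfd_diffN f v : smooth_fun U f ->
  mfd_diff (fun q => - f q) p v = - mfd_diff f p v.
Proof.
move=> Hf; rewrite -mulN1r -mfd_diffMl //.
by apply: mfd_diff_eq => q _; rewrite mulN1r.
Qed.

Lemma chart_change_diff c : chart_dom c p ->
  differentiable (chart_map (chart_at at_ p) \o chart_inv c) (chart_map c p).
Proof.
move=> dp; apply: differentiable_row => i.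
by apply: C_infty_diff (chart_transition (s:=at_) c (chart_at at_ p) i) _; exists p.
Qed.

(** [mfd_diff] at [p] is computed in the chart chosen at [p], which changes with [p]. The chain rule
    rewrites it in one fixed chart, where it can be differentiated further. *)
Lemma mfd_diff_chart c f v : smooth_fun U f -> chart_dom c p ->
  mfd_diff f p v =
  \sum_i 'D_(delta_mx 0 i) (f \o chart_inv c : E -> R^o) (chart_map c p) *
         mfd_diff (fun q => chart_map c q 0 i) p v.
Proof.
move=> Hf dp; have dd := chart_at_dom at_ p; set d := chart_at at_ p in dd *.
have E1 : mfd_diff f p v = 'D_v ((f \o chart_inv c) \o
    (chart_map c \o chart_inv d) : E -> R^o) (chart_map d p).
  apply: near_eq_derive.
  apply: (open_near_eq (open_chart_imageI d (open_chart_dom c))); first by exists p.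
  by move=> _ [q [cq dq] <-] /=; rewrite !chart_mapK.
have dt : differentiable (chart_map c \o chart_inv d) (chart_map d p).
  apply: differentiable_row => i.
  by apply: C_infty_diff (chart_transition (s:=at_) d c i) _; exists p.
rewrite E1 derive_comp_partials //=; first by rewrite chart_mapK.
by rewrite chart_mapK //; exact: smooth_fun_diff Hf Up dp.
Qed.

End DirectionalDerivative.

Lemma smooth_fun_mfd_diff U f X : open U -> smooth_fun U f -> smooth_vf U X ->
  smooth_fun U (fun p => mfd_diff f p (X p)).
Proof.
move=> oU Hf HX c; have oI := open_chart_imageI c oU => k.
pose F i x := 'D_(delta_mx 0 i) (f \o chart_inv c : E -> R^o) x *
   ((fun p => mfd_diff (fun q => chart_map c q 0 i) p (X p)) \o chart_inv c) x.
apply: (@C_k_eq _ _ _ (fun x => \sum_(i < 3) F i x)) => //.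
  move=> _ [p [Up cp] <-]; rewrite /F /= chart_mapK //.
  by rewrite (mfd_diff_chart Up _ Hf cp).
apply: C_k_sum => // i; apply: C_k_mul => //.
  exact: (C_infty_derive i (Hf c)).
by have := HX c i c k; rewrite -setIA setIid.
Qed.

Lemma smooth_vf_sub U V X : V `<=` U -> smooth_vf U X -> smooth_vf V X.
Proof.
by move=> VU HX c i; apply: smooth_fun_sub (HX c i) => p [/VU].
Qed.

Lemma smooth_vf_eq U X Y : open U -> (forall p, U p -> X p = Y p) ->
  smooth_vf U X -> smooth_vf U Y.
Proof.
move=> oU XY HX c i; apply: smooth_fun_eq (HX c i).
  by apply: openI => //; exact: open_chart_dom.
by move=> p [Up _]; rewrite XY.
Qed.

Lemma smooth_vf_local U X :
  (forall p, U p -> exists2 W, W p & smooth_vf W X) -> smooth_vf U X.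
Proof.
move=> H c i; apply: smooth_fun_local => p [Up cp].
by have [W Wp HX] := H p Up; exists (W `&` chart_dom c).
Qed.

Lemma smooth_vf0 U : open U -> smooth_vf U (fun=> 0).
Proof.
move=> oU c i.
have oI : open (U `&` chart_dom c) by apply: openI => //; exact: open_chart_dom.
apply: smooth_fun_eq oI _ (smooth_fun_cst _ 0) => p [Up cp].
have := mfd_diff_linear cp (-1) 0 0 (smooth_chart_map c i).
by rewrite scaler0 addr0 mulN1r addNr.
Qed.

Lemma smooth_vf_lin U f X Y : open U -> smooth_fun U f -> smooth_vf U X ->
  smooth_vf U Y -> smooth_vf U (fun p => f p *: X p + Y p).
Proof.
move=> oU Hf HX HY c i.
have oI : open (U `&` chart_dom c) by apply: openI => //; exact: open_chart_dom.
apply: smooth_fun_eq oI _ (smooth_funD oI (smooth_funM oI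
  (smooth_fun_sub (@subIsetl _ _ _) Hf) (HX c i)) (HY c i)) => p [Up cp].
by rewrite (mfd_diff_linear cp _ _ _ (smooth_chart_map c i)).
Qed.

Lemma smooth_vfZ U f X : open U -> smooth_fun U f -> smooth_vf U X ->
  smooth_vf U (fun p => f p *: X p).
Proof.
move=> oU Hf HX; have := smooth_vf_lin oU Hf HX (smooth_vf0 oU).
by apply: smooth_vf_eq => // p _; rewrite addr0.
Qed.

Lemma smooth_vfD U X Y : open U -> smooth_vf U X -> smooth_vf U Y ->
  smooth_vf U (fun p => X p + Y p).
Proof.
move=> oU HX HY; have := smooth_vf_lin oU (smooth_fun_cst U 1) HX HY.
by apply: smooth_vf_eq => // p _; rewrite scale1r.
Qed.

(** The [k]-th coordinate field of the chart [c]. Its components at [q] refer to the chart chosen at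
    [q], so they are partial derivatives of the transition map from [c] to that chart. *)
Definition coord_vf c (k : 'I_3) (q : M) : E :=
  \row_i 'D_(delta_mx 0 k)
    ((fun x => chart_map (chart_at at_ q) (chart_inv c x) 0 i) : E -> R^o)
    (chart_map c q).

Lemma mfd_diff_coord_vf U c f k q : open U -> U q -> chart_dom c q ->
  smooth_fun U f -> mfd_diff f q (coord_vf c k q) =
  'D_(delta_mx 0 k) (f \o chart_inv c : E -> R^o) (chart_map c q).
Proof.
move=> oU Uq cq Hf; have dq := chart_at_dom at_ q; set d := chart_at at_ q in dq *.
have df : differentiable (f \o chart_inv d : E -> R^o) (chart_map d q).
  exact: smooth_fun_diff Hf Uq dq.
have -> : 'D_(delta_mx 0 k) (f \o chart_inv c : E -> R^o) (chart_map c q) =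
  'D_(delta_mx 0 k) ((f \o chart_inv d) \o (chart_map d \o chart_inv c) : E -> R^o)
    (chart_map c q).
  apply: near_eq_derive.
  apply: (open_near_eq (open_chart_imageI c (open_chart_dom d))); first by exists q.
  by move=> _ [p [dp cp] <-] /=; rewrite !chart_mapK.
rewrite derive_comp_partials /=.
- rewrite /mfd_diff derive_partials //; apply: eq_bigr => i _.
  by rewrite mxE mulrC /= chart_mapK.
- exact: chart_change_diff.
- by rewrite chart_mapK.
Qed.

(** The components in a chart [d] are partial derivatives of the transition map from [c] to [d],
    pulled back by [chart_map c]: the chart chosen at the point has disappeared. *)
Lemma smooth_coord_vf c k : smooth_vf (chart_dom c) (coord_vf c k).
Proof.
move=> d i.
have oI : open (chart_dom c `&` chart_dom d) by apply: openI; exact: open_chart_dom.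
pose h x := 'D_(delta_mx 0 k) ((fun y => chart_map d (chart_inv c y) 0 i) : E -> R^o) x.
apply: (@smooth_fun_eq _ (h \o chart_map c)) => //.
  move=> q [cq dq]; rewrite /h /=.
  by rewrite (mfd_diff_coord_vf _ (open_chart_dom d) dq cq (smooth_chart_map d i)).
move=> b n; apply: (@C_k_comp _ _ _ (chart_map c @` ((chart_dom c `&` chart_dom d))) h
  (chart_map c \o chart_inv b)).
- exact: open_chart_imageI.
- by rewrite setIC; apply: open_chart_imageI; exact: open_chart_dom.
- by move=> _ [q [[cq dq] bq] <-] /=; rewrite chart_mapK //; exists q.
- move=> j m; apply: C_k_sub (chart_transition (s:=at_) b c j m).
  by move=> _ [q [[cq dq] bq] <-]; exists q.
- exact: (C_infty_derive k (chart_transition (s:=at_) c d i)).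
Qed.

End ManifoldCalculus.

(** * Linear algebra of a metric in dimension three: volume form and Hodge star *)

Section LorentzianAlgebra.
Variable R : realType.
Local Notation tvec := 'rV[R]_3.
Local Notation covec := 'cV[R]_3.

Lemma sum3 (V : nmodType) (F : 'I_3 -> V) : \sum_i F i = F 0 + F 1 + F 2.
Proof.
rewrite !big_ord_recl big_ord0 addr0 addrA.
by congr (F _ + F _ + F _); apply: val_inj.
Qed.

Lemma sum2 (V : nmodType) (F : 'I_2 -> V) : \sum_i F i = F 0 + F 1.
Proof. by rewrite !big_ord_recl big_ord0 addr0; congr (F _ + F _); apply: val_inj. Qed.

Lemma forall3 (P : 'I_3 -> Prop) : P 0 -> P 1 -> P 2 -> forall i, P i.
Proof.
by move=> P0 P1 P2 [[|[|[|]]] Hi] //; [move: P0|move: P1|move: P2];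
  congr P; apply: val_inj.
Qed.

Lemma forall2 (P : 'I_2 -> Prop) : P 0 -> P 1 -> forall i, P i.
Proof.
by move=> P0 P1 [[|[|]] Hi] //; [move: P0|move: P1]; congr P; apply: val_inj.
Qed.

Lemma det2E (A : 'M[R]_2) : \det A = A 0 0 * A 1 1 - A 0 1 * A 1 0.
Proof.
rewrite (expand_det_row _ 0) sum2 /cofactor !det_mx11 !mxE /=.
have -> : lift 0 0 = 1 :> 'I_2 by apply: val_inj.
have -> : lift 1 0 = 0 :> 'I_2 by apply: val_inj.
by rewrite /= expr0 expr1; ring.
Qed.

Lemma det3E (A : 'M[R]_3) : \det A =
  A 0 0 * (A 1 1 * A 2 2 - A 1 2 * A 2 1) -
  A 0 1 * (A 1 0 * A 2 2 - A 1 2 * A 2 0) +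
  A 0 2 * (A 1 0 * A 2 1 - A 1 1 * A 2 0).
Proof.
rewrite (expand_det_row _ 0) sum3 /cofactor !det2E !mxE /=.
have -> : lift 0 0 = 1 :> 'I_3 by apply: val_inj.
have -> : lift 0 1 = 2 :> 'I_3 by apply: val_inj.
have -> : lift 1 0 = 0 :> 'I_3 by apply: val_inj.
have -> : lift 1 1 = 2 :> 'I_3 by apply: val_inj.
have -> : lift 2 0 = 0 :> 'I_3 by apply: val_inj.
have -> : lift 2 1 = 1 :> 'I_3 by apply: val_inj.
by rewrite /= expr0 expr1 sqrrN expr1n; ring.
Qed.

Lemma evE (a : covec) (v : tvec) :
  ev a v = v 0 0 * a 0 0 + v 0 1 * a 1 0 + v 0 2 * a 2 0.
Proof. by rewrite /ev mxE sum3. Qed.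

Lemma bilE (G : 'M[R]_3) (v w : tvec) : bil G v w =
  v 0 0 * (G 0 0 * w 0 0 + G 0 1 * w 0 1 + G 0 2 * w 0 2) +
  v 0 1 * (G 1 0 * w 0 0 + G 1 1 * w 0 1 + G 1 2 * w 0 2) +
  v 0 2 * (G 2 0 * w 0 0 + G 2 1 * w 0 1 + G 2 2 * w 0 2).
Proof. by rewrite /bil -mulmxA mxE sum3 !mxE !sum3 !mxE. Qed.

Lemma evDl (k : R) a b (v : tvec) : ev (k *: a + b) v = k * ev a v + ev b v.
Proof. by rewrite !evE !mxE; ring. Qed.

Lemma evDr (k : R) a (v w : tvec) : ev a (k *: v + w) = k * ev a v + ev a w.
Proof. by rewrite !evE !mxE; ring. Qed.

Lemma evZl (k : R) a (v : tvec) : ev (k *: a) v = k * ev a v.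
Proof. by rewrite !evE !mxE; ring. Qed.

Lemma bilDl G (k : R) (v w x : tvec) : bil G (k *: v + w) x = k * bil G v x + bil G w x.
Proof. by rewrite !bilE !mxE; ring. Qed.

Lemma bil_addr G (v w x : tvec) : bil G x (v + w) = bil G x v + bil G x w.
Proof. by rewrite !bilE !mxE; ring. Qed.

Lemma bilZl G (k : R) (v x : tvec) : bil G (k *: v) x = k * bil G v x.
Proof. by rewrite !bilE !mxE; ring. Qed.

Lemma ev_inj (a b : covec) : (forall v, ev a v = ev b v) -> a = b.
Proof.
move=> H; apply/matrixP => i j; rewrite ord1.
by have := H (delta_mx 0 i); rewrite /ev -!rowE !mxE.
Qed.

Lemma det_lorentz_gram : \det (lorentz_gram R) = -1.
Proof. by rewrite det3E !mxE /=; ring. Qed.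

Definition cross (x y : tvec) : covec :=
  \col_i (if i == 0 then x 0 1 * y 0 2 - x 0 2 * y 0 1
          else if i == 1 then x 0 2 * y 0 0 - x 0 0 * y 0 2
          else x 0 0 * y 0 1 - x 0 1 * y 0 0).

(** The sign and the determinant both refer to the chart chosen at a point; only the product with
    the determinant of three vectors has an invariant meaning. *)
Definition density (G : 'M[R]_3) (s : bool) : R := (-1) ^+ s * Num.sqrt `|\det G|.

Definition vol (G : 'M[R]_3) (s : bool) (x y z : tvec) : R :=
  density G s * ev (cross x y) z.

Lemma det_rows (V : 'M[R]_3) : ev (cross (row 0 V) (row 1 V)) (row 2 V) = \det V.
Proof. by rewrite evE det3E !mxE /=; ring. Qed.

Lemma trace_rank1 (W : 'M[R]_3) (x y : tvec) : \tr (W^T *m (x^T *m y)) = bil W x y.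
Proof.
by rewrite bilE /mxtrace sum3 !mxE !sum3 !mxE !big_ord1 !mxE; ring.
Qed.

Lemma twoformE (W : 'M[R]_3) : twoform W -> forall i j, W j i = - W i j.
Proof. by move=> H i j; have /matrixP/(_ i j) := H; rewrite !mxE. Qed.

Lemma bil_twoform (W : 'M[R]_3) (x y : tvec) : twoform W -> bil W x y =
  W 0 1 * cross x y 2 0 + W 1 2 * cross x y 0 0 + W 2 0 * cross x y 1 0.
Proof.
move=> H; have W0 i : W i i = 0 by have := twoformE H i i; lra.
rewrite bilE !mxE /= !W0 (twoformE H 0 1) (twoformE H 1 2) (twoformE H 2 0); ring.
Qed.

Lemma wedge21E (W V : 'M[R]_3) (a : covec) : twoform W -> wedge21 W a V =
  (W 0 1 * a 2 0 + W 1 2 * a 0 0 + W 2 0 * a 1 0) * \det V.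
Proof.
move=> H; rewrite /wedge21 !bil_twoform // !evE det3E !mxE /=; ring.
Qed.

Section Metric.
Variables (G : 'M[R]_3) (s : bool).
Hypotheses (symG : G^T = G) (unitG : G \in unitmx).

Lemma symE i j : G i j = G j i.
Proof. by rewrite -[in LHS]symG mxE. Qed.

Lemma bilC v w : bil G v w = bil G w v.
Proof. by rewrite !bilE (symE 1 0) (symE 2 0) (symE 2 1); ring. Qed.

Lemma sharpE a : sharp G a = a^T *m invmx G.
Proof. by rewrite /sharp trmx_mul trmx_inv symG. Qed.

Lemma bil_sharp a v : bil G (sharp G a) v = ev a v.
Proof.
by rewrite sharpE /bil /ev mulmxKV // -trmx_mul mxE.
Qed.

Lemma ev_flat v w : ev (flat G v) w = bil G v w.
Proof. by rewrite bilC /ev /flat /bil mulmxA. Qed.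

Lemma cometric_sharp a b : cometric G a b = ev b (sharp G a).
Proof. by rewrite /cometric /ev sharpE. Qed.

Lemma flatK v : sharp G (flat G v) = v.
Proof. by rewrite /sharp /flat mulKmx // trmxK. Qed.

Lemma sharpK a : flat G (sharp G a) = a.
Proof. by rewrite /sharp /flat trmxK mulKVmx. Qed.

(** Raising both indices of the wedge of [a] and [flat G w] gives the antisymmetrization of
    [sharp G a] and [w]. Its trace against the skew [W] counts [bil W (sharp G a) w] twice, which
    the factor [2^-1] compensates. *)
Lemma twoform_metricE W a w : twoform W ->
  twoform_metric G W (wedge11 a (flat G w)) = bil W (sharp G a) w.
Proof.
move=> HW; have E1 : invmx G *m wedge11 a (flat G w) *m invmx G =
    (sharp G a)^T *m w - w^T *m sharp G a.
  have -> : (sharp G a)^T = invmx G *m a by rewrite /sharp trmxK.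
  rewrite sharpE /wedge11 /flat mulmxBr mulmxBl trmx_mul trmxK symG.
  by rewrite !mulmxA mulmxK // mulVmx // mul1mx.
rewrite /twoform_metric -!mulmxA mulmxA -mulmxA [invmx G *m _]mulmxA E1.
rewrite mulmxBr linearB /=.
rewrite !trace_rank1 !bil_twoform // !mxE /=. lra.
Qed.

(* For one-forms [a] and [b = flat w] this is [*(a /\ b) = vol(a^#, w, .)]. *)
Lemma hodge_star2E a w :
  hodge_star2 G s (wedge11 a (flat G w)) = density G s *: cross (sharp G a) w.
Proof.
set c := _ *: _; set P := fun b : covec => forall W, twoform W -> forall V,
  wedge21 W b V = twoform_metric G W (wedge11 a (flat G w)) * volume_form G s V.
have Pc : P c.
  move=> W HW V; rewrite twoform_metricE // wedge21E // bil_twoform //.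
  by rewrite /c /volume_form -/(density G s) !mxE /=; ring.
have Ph : P (hodge_star2 G s (wedge11 a (flat G w))) by apply: (xgetPex 0); exists c.
(* Uniqueness of the star: on the identity matrix, [wedge21] with this two-form is evaluation at
   [k], so testing on all of them determines the one-form. *)
have tw (k : tvec) : twoform (\matrix_(i < 3, j < 3) (if (i == 0) && (j == 1) then k 0 2
    else if (i == 1) && (j == 0) then - k 0 2 else if (i == 1) && (j == 2) then k 0 0
    else if (i == 2) && (j == 1) then - k 0 0 else if (i == 2) && (j == 0) then k 0 1
    else if (i == 0) && (j == 2) then - k 0 1 else 0) : 'M[R]_3).
  by apply/matrixP; apply: forall3; apply: forall3; rewrite !mxE /= ?opprK ?oppr0.
apply: ev_inj => v; have := Ph _ (tw v) 1%:M; rewrite -(Pc _ (tw v) 1%:M).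
by rewrite !wedge21E ?det1 ?mulr1 //; rewrite !evE !mxE /= => H; move: H; lra.
Qed.

End Metric.
End LorentzianAlgebra.

(** * Null frames and the matrix model of Clifford multiplication *)

Section NullFrames.
Variable R : realType.
Local Notation tvec := 'rV[R]_3.
Local Notation covec := 'cV[R]_3.

Lemma gram_entry (G F : 'M[R]_3) i j :
  (F *m G *m F^T) i j = bil G (row i F) (row j F).
Proof.
rewrite /bil -row_mul tr_row mxE [RHS]mxE.
by apply: eq_bigr => k _; rewrite !mxE.
Qed.

Definition rows3 (x y z : tvec) : 'M[R]_3 :=
  \matrix_(i < 3) (if i == 0 then x else if i == 1 then y else z).

Lemma row0_rows3 x y z : row 0 (rows3 x y z) = x. Proof. by rewrite rowK. Qed.
Lemma row1_rows3 x y z : row 1 (rows3 x y z) = y. Proof. by rewrite rowK. Qed.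
Lemma row2_rows3 x y z : row 2 (rows3 x y z) = z. Proof. by rewrite rowK. Qed.
Definition row_rows3 := (row0_rows3, row1_rows3, row2_rows3).

Lemma bil_comb (G : 'M[R]_3) a b c (x y z w : tvec) :
  bil G (a *: x + b *: y + c *: z) w = a * bil G x w + b * bil G y w + c * bil G z w.
Proof. by rewrite !bilE !mxE; ring. Qed.

Lemma det_rows3 x y z : \det (rows3 x y z) = ev (cross x y) z.
Proof. by rewrite -det_rows !row_rows3. Qed.

Lemma ev_delta i (v : tvec) : ev (delta_mx i 0) v = v 0 i.
Proof. by rewrite /ev -colE mxE. Qed.

Definition null_gram : 'M[R]_3 :=
  \matrix_(i < 3, j < 3) (((i == 0) && (j == 1)) || ((i == 1) && (j == 0))
     || ((i == 2) && (j == 2)))%:R.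

Lemma null_gramK : null_gram *m null_gram = 1%:M.
Proof.
by apply/matrixP; apply: forall3; apply: forall3; rewrite !mxE sum3 !mxE /=; ring.
Qed.

Record null_frame (G : 'M[R]_3) (s : bool) (K U n : tvec) : Prop := NullFrame {
  null_frameKK : bil G K K = 0;
  null_frameUU : bil G U U = 0;
  null_framenn : bil G n n = 1;
  null_frameKU : bil G K U = 1;
  null_frameKn : bil G K n = 0;
  null_frameUn : bil G U n = 0;
  null_frame_vol : vol G s K U n = 1
}.

(* Clifford multiplication by [a], acting on row vectors from the right, in a
   basis [(eps, Gamma(K^b) eps)] of the spinors with [Gamma(U^b) eps = 0].
   Products therefore appear in reverse order below. *)
Definition clifford_mx (l : R) (K U n : tvec) (a : covec) : 'M[R]_2 :=
  \matrix_(i < 2, j < 2)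
    (if i == 0 then (if j == 0 then l * ev a n else ev a U)
     else (if j == 0 then 2 * ev a K else - (l * ev a n))).

Lemma clifford_mx_linear l K U n k a b : clifford_mx l K U n (k *: a + b) =
  k *: clifford_mx l K U n a + clifford_mx l K U n b.
Proof.
by apply/matrixP; apply: forall2; apply: forall2; rewrite !mxE /= !evDl; ring.
Qed.

Section Frame.
Variables (G : 'M[R]_3) (s : bool) (K U n : tvec).
Hypotheses (symG : G^T = G) (unitG : G \in unitmx) (nf : null_frame G s K U n).

Lemma null_frame_gram :
  rows3 K U n *m G *m (rows3 K U n)^T = null_gram.
Proof.
case: nf => KK UU nn KU Kn Un _.
apply/matrixP; apply: forall3; apply: forall3; rewrite gram_entry !row_rows3 !mxE /=
  ?(bilC symG U K) ?(bilC symG n K) ?(bilC symG n U) //.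
Qed.

(** The Gram matrix of [(K, U, n)] is its own inverse and exchanges [K] and [U]: a component along
    [K] is a product with [U], and conversely. *)
Lemma null_frame_expand x :
  x = bil G x U *: K + bil G x K *: U + bil G x n *: n.
Proof.
set F := rows3 K U n.
have H : G *m F^T *m null_gram *m F = 1%:M.
  by apply: mulmx1C; rewrite !mulmxA null_frame_gram null_gramK.
rewrite -[LHS]mulmx1 -H !mulmxA mulmx_sum_row sum3 !row_rows3.
have E1 i : (x *m G *m F^T) 0 i = bil G x (row i F).
  by rewrite /bil tr_row mxE [RHS]mxE; apply: eq_bigr => k _; rewrite !mxE.
by congr (_ *: _ + _ *: _ + _ *: _); rewrite mxE sum3 !E1 !row_rows3 !mxE /=; ring.
Qed.

Lemma null_frame_sharp a : sharp G a = ev a U *: K + ev a K *: U + ev a n *: n.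
Proof. by rewrite [LHS]null_frame_expand !bil_sharp. Qed.

Lemma null_frame_cometric a b : cometric G a b =
  ev a U * ev b K + ev a K * ev b U + ev a n * ev b n.
Proof.
by rewrite cometric_sharp // null_frame_sharp !evE !mxE; ring.
Qed.

Lemma null_frame_bil x y : bil G x y =
  bil G x U * bil G y K + bil G x K * bil G y U + bil G x n * bil G y n.
Proof.
rewrite {1}(null_frame_expand x) bil_comb.
by rewrite (bilC symG y K) (bilC symG y U) (bilC symG y n).
Qed.

Lemma vol_linear (cK cU cn dK dU dn : R) z :
  vol G s (cK *: K + cU *: U + cn *: n) (dK *: K + dU *: U + dn *: n) z =
  (cK * dU - cU * dK) * vol G s K U z + (cU * dn - cn * dU) * vol G s U n z
  + (cn * dK - cK * dn) * vol G s n K z.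
Proof. by rewrite /vol !evE !mxE /=; ring. Qed.

Lemma vol_cyc x y z : vol G s x y z = vol G s z x y.
Proof. by rewrite /vol !evE !mxE /=; ring. Qed.

Lemma vol_alt x y : vol G s x y x = 0.
Proof. by rewrite /vol !evE !mxE /=; ring. Qed.

Lemma null_frame_vols x y :
  [/\ vol G s x y K = bil G x K * bil G y n - bil G x n * bil G y K,
      vol G s x y U = bil G x n * bil G y U - bil G x U * bil G y n &
      vol G s x y n = bil G x U * bil G y K - bil G x K * bil G y U].
Proof.
have V1 := null_frame_vol nf.
have V2 : vol G s U n K = 1 by rewrite vol_cyc.
have V3 : vol G s n K U = 1 by rewrite vol_cyc.
have A1 a b : vol G s a b b = 0 by rewrite vol_cyc vol_alt.
by split; rewrite {1}(null_frame_expand x) {1}(null_frame_expand y) vol_linear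
  ?vol_alt ?A1 ?V1 ?V2 ?V3; ring.
Qed.

Definition hodge_product (a b : covec) : covec :=
  hodge_star2 G s (wedge11 a b).

Lemma ev_hodge a b v : ev (hodge_product a b) v = vol G s (sharp G a) (sharp G b) v.
Proof.
by rewrite /hodge_product -{1}[b](@sharpK _ G) // hodge_star2E // evZl.
Qed.

Lemma ev_hodge_frame a b :
  [/\ ev (hodge_product a b) K = ev a K * ev b n - ev a n * ev b K,
      ev (hodge_product a b) U = ev a n * ev b U - ev a U * ev b n &
      ev (hodge_product a b) n = ev a U * ev b K - ev a K * ev b U].
Proof.
by rewrite !ev_hodge; have := null_frame_vols (sharp G a) (sharp G b); rewrite !bil_sharp.
Qed.

Lemma clifford_mx_sqr l a : l * l = 1 ->
  clifford_mx l K U n a *m clifford_mx l K U n a = (cometric G a a)%:M.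
Proof.
move=> l2; rewrite null_frame_cometric; apply/matrixP.
have E1 x y : l * x * (l * y) = x * y by rewrite mulrACA l2 mul1r.
by apply: forall2; apply: forall2;
  rewrite !mxE sum2 !mxE /= ?mulrNN ?E1 ?mulr0n ?mulr1n; ring.
Qed.

(** The antisymmetric part can be predicted in an orthonormal coframe: [e^0 e^1 e^2 = l] and
    [e^2 e^2 = -1] give [e^0 e^1 = - l e^2], with [e^2] the star of the wedge of [e^0] and [e^1];
    hence the minus sign. In null components both sides are polynomials that agree once
    [l * l = 1]. *)
Lemma clifford_mx_mul l a b : l * l = 1 ->
  clifford_mx l K U n b *m clifford_mx l K U n a =
  (cometric G a b)%:M - l *: clifford_mx l K U n (hodge_product a b).
Proof.
move=> l2; have [HK HU Hn] := ev_hodge_frame a b.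
rewrite null_frame_cometric; apply/matrixP.
have E1 x y : l * x * (l * y) = x * y by rewrite mulrACA l2 mul1r.
have E2 x : l * (l * x) = x by rewrite mulrA l2 mul1r.
by apply: forall2; apply: forall2; rewrite !mxE sum2 !mxE /= ?HK ?HU ?Hn
  ?mulr0n ?mulr1n ?mulrNN ?E1 ?mulrN ?E2; ring.
Qed.

End Frame.

(** No relation between [K], [U] and [n] is assumed: the identity serves to determine their
    orientation, before they are known to form a [null_frame]. *)
Lemma clifford_mx_trace l K U n a b c :
  \tr (clifford_mx l K U n c *m clifford_mx l K U n b *m clifford_mx l K U n a) =
  2 * l * \det (\matrix_(i < 3, j < 3)
    ev (if j == 0 then a else if j == 1 then b else c)
       (if i == 0 then K else if i == 1 then U else n)).
Proof.
by rewrite det3E /mxtrace sum2 !mxE !sum2 !mxE !sum2 !mxE /=; ring.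
Qed.
End NullFrames.

(** * Orthonormal frames, orientation, and recognition of null frames *)

Section FrameConstruction.
Variable R : realType.
Local Notation tvec := 'rV[R]_3.
Local Notation covec := 'cV[R]_3.

Lemma lorentz_gramK : lorentz_gram R *m lorentz_gram R = 1%:M.
Proof.
by apply/matrixP; apply: forall3; apply: forall3; rewrite !mxE sum3 !mxE /=; ring.
Qed.

Lemma positive_invmx s (V : 'M[R]_3) : positive s V -> positive s (invmx V).
Proof.
rewrite /positive det_inv => H.
have d0 : \det V != 0 by apply: contraTneq H => ->; rewrite mulr0 ltxx.
have -> : (-1) ^+ s * (\det V)^-1 = (-1) ^+ s * \det V * (\det V)^-1 ^+ 2.
  by rewrite expr2 mulrA mulfK.
by rewrite mulr_gt0 // exprn_even_gt0 // invr_eq0 d0.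
Qed.

Section OrthonormalFrame.
Variables (G : 'M[R]_3) (s : bool) (e : 'M[R]_3).
Hypotheses (symG : G^T = G) (orth : e *m G *m e^T = lorentz_gram R).

Lemma orthonormal_det : \det e * \det e * \det G = -1.
Proof. by rewrite -(det_lorentz_gram R) -orth !det_mulmx det_tr; ring. Qed.

Lemma orthonormal_unit : e \in unitmx.
Proof.
rewrite unitmxE unitfE; apply/eqP => d0; have := orthonormal_det.
by rewrite d0 !mul0r; lra.
Qed.

Lemma metric_unit : G \in unitmx.
Proof.
rewrite unitmxE unitfE; apply/eqP => d0; have := orthonormal_det.
by rewrite d0 mulr0; lra.
Qed.

Lemma metric_det_lt0 : \det G < 0.
Proof.
rewrite ltNge; apply/negP => G0; have := mulr_ge0 (sqr_ge0 (\det e)) G0.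
by rewrite expr2 orthonormal_det; lra.
Qed.

Lemma density_sqr : density G s * density G s = - \det G.
Proof.
have dG := metric_det_lt0; rewrite /density mulrACA -expr2 sqrr_sign mul1r.
by rewrite -expr2 sqr_sqrtr // ltr0_norm.
Qed.

(** The product is positive because [e] is a positive basis, and its square is [- det G] times the
    square of [det e], that is [1]. *)
Lemma adapted_density : positive s e -> density G s * \det e = 1.
Proof.
rewrite /positive => pos; have dG := metric_det_lt0.
have s0 : 0 < Num.sqrt `|\det G| by rewrite sqrtr_gt0 normr_gt0 lt_eqF.
have x0 : 0 < density G s * \det e by rewrite /density mulrAC mulr_gt0.
have x1 : (density G s * \det e) * (density G s * \det e) = 1.
  by rewrite mulrACA density_sqr; have := orthonormal_det; lra.
set x := density G s * \det e in x0 x1 *; nra.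
Qed.

Lemma orthonormal_expand x : x =
  bil G x (row 0 e) *: row 0 e + bil G x (row 1 e) *: row 1 e
  - bil G x (row 2 e) *: row 2 e.
Proof.
have H : G *m e^T *m lorentz_gram R *m e = 1%:M.
  by apply: mulmx1C; rewrite !mulmxA orth lorentz_gramK.
rewrite -[LHS]mulmx1 -H !mulmxA mulmx_sum_row sum3.
have E1 i : (x *m G *m e^T) 0 i = bil G x (row i e).
  by rewrite /bil tr_row mxE [RHS]mxE; apply: eq_bigr => k _; rewrite !mxE.
by rewrite -scaleNr; congr (_ *: _ + _ *: _ + _ *: _);
  rewrite mxE sum3 !E1 !mxE /=; ring.
Qed.

End OrthonormalFrame.

(** Both sides are tested on the dual frame [e = invmx E]. Raising the index of the two spacelike
    covectors gives the first two vectors of [e] without a sign, so the left side takes the values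
    [vol(e_0, e_1, e_i)]. *)
Lemma coframe_hodge (G E : 'M[R]_3) s : G^T = G -> G \in unitmx ->
  E^T *m invmx G *m E = lorentz_gram R -> positive s E ->
  hodge_product G s (col 0 E) (col 1 E) = col 2 E.
Proof.
move=> symG unitG orthE posE.
have unitE : E \in unitmx.
  rewrite unitmxE unitfE; apply/eqP => d0; have := det_lorentz_gram R.
  by rewrite -orthE !det_mulmx det_tr d0 !mul0r; lra.
pose e := invmx E.
have EG : E^T *m invmx G = lorentz_gram R *m e by rewrite -orthE mulmxK.
have orthe : e *m G *m e^T = lorentz_gram R.
  have : E^T *m invmx G *m E *m (e *m G *m e^T) = 1%:M.
    by rewrite !mulmxA mulmxK // mulmxKV // trmx_inv mulmxV // unitmx_tr.
  by rewrite orthE => /(congr1 (mulmx (lorentz_gram R)));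
    rewrite mulmxA lorentz_gramK mul1mx mulmx1.
have pose_ : positive s e. by exact: positive_invmx.
have sharp_col i : sharp G (col i E) = row i (lorentz_gram R *m e).
  by rewrite sharpE // tr_col -row_mul EG.
have s0 : sharp G (col 0 E) = row 0 e.
  by rewrite sharp_col; apply/rowP => j; rewrite !mxE sum3 !mxE /=; ring.
have s1 : sharp G (col 1 E) = row 1 e.
  by rewrite sharp_col; apply/rowP => j; rewrite !mxE sum3 !mxE /=; ring.
have vole : vol G s (row 0 e) (row 1 e) (row 2 e) = 1.
  by rewrite /vol det_rows adapted_density.
suff H : e *m hodge_product G s (col 0 E) (col 1 E) = e *m col 2 E.
  by rewrite -[LHS](mulKVmx unitE) H mulKVmx.
have entry (a : covec) i : (e *m a) i 0 = ev a (row i e).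
  by rewrite /ev -row_mul [RHS]mxE.
have ce i : ev (col 2 E) (row i e) = (i == 2)%:R.
  by rewrite -entry colE mulmxA mulVmx // mul1mx mxE andbT.
apply/matrixP => i j; rewrite ord1 {j} !entry ce ev_hodge // s0 s1.
move: i; apply: forall3; rewrite /= ?vole //.
- by rewrite vol_alt.
- by rewrite vol_cyc vol_alt.
Qed.

(** The first two covectors are orthogonal, so their Clifford product is [- l] times the third, and
    the third squares to [-1]. *)
Lemma clifford_coframe (G E : 'M[R]_3) s (l : R) (K U n : tvec) :
  G^T = G -> G \in unitmx ->
  null_frame G s K U n -> l * l = 1 ->
  E^T *m invmx G *m E = lorentz_gram R -> positive s E ->
  clifford_mx l K U n (col 2 E) *m clifford_mx l K U n (col 1 E) *m
    clifford_mx l K U n (col 0 E) = l%:M.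
Proof.
move=> symG unitG nf l2 orthE posE.
have Eg i j : cometric G (col i E) (col j E) = lorentz_gram R i j.
  by rewrite -orthE /cometric tr_col -row_mul [RHS]mxE mxE;
    apply: eq_bigr => k _; rewrite !mxE.
rewrite -mulmxA (clifford_mx_mul symG unitG nf _ _ l2) coframe_hodge // Eg.
rewrite mulmxBr -scalemxAr (clifford_mx_sqr symG unitG nf _ l2) Eg.
apply/matrixP; apply: forall2; apply: forall2;
  rewrite !mxE ?sum2 !mxE /= ?mulr0n ?mulr1n; ring.
Qed.

(* [Gamma(nu) = l] fixes the orientation of the frame because the trace of
   [Gamma(e^0) Gamma(e^1) Gamma(e^2)] is [2 l] times its determinant. *)
Lemma clifford_null_frame (G e : 'M[R]_3) s (l : R) (K U n : tvec) : G^T = G ->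
  e *m G *m e^T = lorentz_gram R -> positive s e -> l != 0 ->
  (forall a, ev a n * ev a n + 2 * ev a K * ev a U = cometric G a a) ->
  (forall E, E^T *m invmx G *m E = lorentz_gram R -> positive s E ->
     clifford_mx l K U n (col 2 E) *m clifford_mx l K U n (col 1 E) *m
       clifford_mx l K U n (col 0 E) = l%:M) ->
  null_frame G s K U n.
Proof.
move=> symG orthe pose_ l0 cliff orient.
have unitG := metric_unit orthe; have unite := orthonormal_unit orthe.
pose F := rows3 K U n.
(* The hypothesis on squares says that the two sides agree as quadratic forms; polarization gives
   the matrices. Inverting then yields the Gram matrix of [K], [U], [n]. *)
have invG : F^T *m null_gram R *m F = invmx G.
  have com i j : invmx G i j = cometric G (delta_mx i 0) (delta_mx j 0).
    by rewrite /cometric trmx_delta -rowE -colE !mxE.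
  have comD a b : cometric G (a + b) (a + b) =
      cometric G a a + cometric G b b + 2 * cometric G a b.
    have symi : (invmx G)^T = invmx G by rewrite trmx_inv symG.
    have bili x y : cometric G x y = bil (invmx G) x^T y^T by rewrite /bil trmxK.
    rewrite !bili !bilE !mxE.
    by rewrite (symE symi 1 0) (symE symi 2 0) (symE symi 2 1); ring.
  apply/matrixP => i j; rewrite com.
  have := comD (delta_mx i 0) (delta_mx j 0).
  rewrite -!cliff.
  have evD a b v : ev (a + b) v = ev a v + ev b v :> R.
    by rewrite -[a]scale1r evDl scale1r mul1r.
  rewrite !evD !ev_delta !mxE sum3 !mxE !sum3 !mxE /= => H.
  lra.
have gramF : F *m G *m F^T = null_gram R.
  have H1 : (F^T *m null_gram R) *m (F *m G) = 1%:M.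
    by rewrite mulmxA invG mulVmx.
  have := mulmx1C H1; rewrite mulmxA => /(congr1 (mulmx^~ (null_gram R))) /=.
  by rewrite -[_ *m _ *m null_gram R]mulmxA null_gramK mulmx1 mul1mx.
have gF i j : bil G (row i F) (row j F) = null_gram R i j by rewrite -gram_entry gramF.
have volF : vol G s K U n = 1.
  rewrite /vol -det_rows3 -/F.
  pose E := invmx e.
  have orthE : E^T *m invmx G *m E = lorentz_gram R.
    have GE : invmx G = e^T *m lorentz_gram R *m e.
      rewrite -[LHS]mul1mx -[in LHS](_ : e^T *m lorentz_gram R *m (e *m G) = 1%:M).
        by rewrite -!mulmxA mulmxV // mulmx1 .
      apply: mulmx1C; rewrite mulmxA orthe lorentz_gramK //.
    by rewrite GE /E !mulmxA trmx_inv mulVmx ?unitmx_tr // mul1mx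
      -mulmxA mulmxV // mulmx1.
  have posE : positive s E. by exact: positive_invmx.
  (* With the coframe dual to [e], the trace reads [2 l (det F / det e) = 2 l], so [F] has the
     determinant of a positive orthonormal frame. *)
  have := orient E orthE posE => /(congr1 mxtrace).
  rewrite clifford_mx_trace mxtrace_scalar.
  have -> : \matrix_(i < 3, j < 3)
    ev (if j == 0 then col 0 E else if j == 1 then col 1 E else col 2 E)
       (if i == 0 then K else if i == 1 then U else n) = F *m E.
    apply/matrixP => i j; rewrite mxE [RHS]mxE /ev mxE.
    apply: eq_bigr => k _; rewrite [F i k]mxE; congr (_ * _).
    by move: j; apply: forall3; rewrite mxE.
  rewrite det_mulmx det_inv => H.
  have d0 : \det e != 0 by rewrite -unitfE -unitmxE.
  suff -> : \det F = \det e by rewrite adapted_density.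
  have : 2 * l * (\det F / \det e - 1) = 0 by rewrite mulrBr H mulr1 mulr_natl subrr.
  move/eqP; rewrite !mulf_eq0 pnatr_eq0 (negbTE l0) /= subr_eq0 => /eqP H1.
  by rewrite -[RHS]mul1r -H1 mulfVK.
by split=> //; [have := gF 0 0|have := gF 1 1|have := gF 2 2|have := gF 0 1
  |have := gF 0 2|have := gF 1 2]; rewrite !row_rows3 mxE.
Qed.

End FrameConstruction.

(** * The null frame spanned by a timelike and an isotropic vector *)

Section NullFrameFromTime.
Variable R : realType.
Local Notation tvec := 'rV[R]_3.
Local Notation covec := 'cV[R]_3.
Variables (G : 'M[R]_3) (s : bool) (e : 'M[R]_3).
Hypotheses (symG : G^T = G) (orth : e *m G *m e^T = lorentz_gram R).
Let unitG := metric_unit orth.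

Lemma orthonormal_bil x y : bil G x y =
  bil G x (row 0 e) * bil G y (row 0 e) + bil G x (row 1 e) * bil G y (row 1 e)
  - bil G x (row 2 e) * bil G y (row 2 e).
Proof.
rewrite {1}(orthonormal_expand orth x) -scaleNr bil_comb.
by rewrite !(bilC symG (row _ e) y) mulNr.
Qed.

(** Let [(a, b, c)] and [(x, y, z)] be the products of [T] and [U] with an orthonormal frame. If
    [g(T, U) = 0], Lagrange's identity on the spacelike parts gives [(a y - b x)^2 = g(T, T) z^2].
    This forces [z = 0], and then [U = 0] by isotropy. *)
Lemma timelike_null_neq0 T U : bil G T T < 0 -> bil G U U = 0 -> U <> 0 ->
  bil G T U != 0.
Proof.
move=> TT UU U0; apply/eqP => TU; apply: U0.
rewrite (orthonormal_expand orth U).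
move: TT UU TU; rewrite !(orthonormal_bil _ T) !(orthonormal_bil _ U).
set a := bil G T (row 0 e); set b := bil G T (row 1 e); set c := bil G T (row 2 e).
set x := bil G U (row 0 e); set y := bil G U (row 1 e); set z := bil G U (row 2 e).
move=> TT UU TU.
have z0 : z = 0.
  apply/eqP/negPn/negP => z0; have z2 : 0 < z * z by rewrite -expr2 exprn_even_gt0.
  have H1 : c * z = a * x + b * y by lra.
  have H2 : (a * a + b * b - c * c) * (z * z) < 0 by rewrite nmulr_rlt0.
  have H3 : (a * y - b * x) ^+ 2 = (a * a + b * b - c * c) * (z * z).
    have -> : (a * a + b * b - c * c) * (z * z) =
      (a * a + b * b) * (z * z) - (c * z) * (c * z) by ring.
    have -> : z * z = x * x + y * y by lra.
    by rewrite H1; ring.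
  by move: (sqr_ge0 (a * y - b * x)); rewrite H3 leNgt H2.
have xy : x ^+ 2 + y ^+ 2 = 0 by rewrite !expr2; move: UU; rewrite z0; lra.
move/eqP: xy; rewrite paddr_eq0 ?sqr_ge0 // !sqrf_eq0 => /andP[/eqP -> /eqP ->].
by rewrite z0 !scale0r addr0 subr0.
Qed.

Hypothesis pos : positive s e.

(** The component along the timelike vector is minus the product with it, which reverses the first
    two minors against the Euclidean cross product. *)
Lemma vol_orthonormal x y :
  [/\ vol G s x y (row 0 e) =
        bil G x (row 2 e) * bil G y (row 1 e) - bil G x (row 1 e) * bil G y (row 2 e),
      vol G s x y (row 1 e) =
        bil G x (row 0 e) * bil G y (row 2 e) - bil G x (row 2 e) * bil G y (row 0 e) &
      vol G s x y (row 2 e) =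
        bil G x (row 0 e) * bil G y (row 1 e) - bil G x (row 1 e) * bil G y (row 0 e)].
Proof.
have V0 : vol G s (row 0 e) (row 1 e) (row 2 e) = 1.
  by rewrite /vol det_rows adapted_density.
have V1 : vol G s (row 1 e) (row 2 e) (row 0 e) = 1 by rewrite vol_cyc.
have V2 : vol G s (row 2 e) (row 0 e) (row 1 e) = 1 by rewrite vol_cyc.
have A1 a b : vol G s a b b = 0 by rewrite vol_cyc vol_alt.
split; rewrite {1}(orthonormal_expand orth x) {1}(orthonormal_expand orth y)
  -!(scaleNr _ (row 2 e))
  vol_linear ?vol_alt ?A1 ?V0 ?V1 ?V2; ring.
Qed.

(** The second null direction of the plane of [T] and [U]: with [m = g(T, U)], the vector [T - c U]
    has square [g(T, T) - 2 c m], which fixes [c]; division by [m] then normalizes the product with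
    [U]. *)
Definition null_partner (T U : tvec) : tvec :=
  (bil G T U)^-1 *: (- (bil G T T / (2 * bil G T U)) *: U + T).

Definition normal_vec (x y : tvec) : tvec := sharp G (density G s *: cross x y).

Lemma bil_normal_vec x y v : bil G (normal_vec x y) v = vol G s x y v.
Proof. by rewrite bil_sharp // evZl. Qed.

Lemma null_partnerE T U v : bil G (null_partner T U) v =
  (bil G T U)^-1 * (- (bil G T T / (2 * bil G T U)) * bil G U v + bil G T v).
Proof. by rewrite /null_partner bilZl bilDl. Qed.

Lemma null_frame_construct T U : bil G T T < 0 -> bil G U U = 0 -> U <> 0 ->
  null_frame G s (null_partner T U) U (normal_vec (null_partner T U) U).
Proof.
move=> TT UU U0; have mu := timelike_null_neq0 TT UU U0.
have two : 2 != 0 :> R by rewrite pnatr_eq0.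
have KU : bil G (null_partner T U) U = 1 by rewrite null_partnerE UU mulr0 add0r mulVf.
have KK : bil G (null_partner T U) (null_partner T U) = 0.
  rewrite null_partnerE (bilC symG U) KU (bilC symG T (null_partner _ _)).
  rewrite null_partnerE (bilC symG U T); move: mu; move: (bil G T U) (bil G T T) => m t m0.
  by field.
set K := null_partner T U in KU KK *.
set n := normal_vec K U.
have nE v : bil G n v = vol G s K U v by exact: bil_normal_vec.
have nn : bil G n n = 1.
  have [V0 V1 V2] := vol_orthonormal K U.
  rewrite orthonormal_bil !nE V0 V1 V2.
  (* Lagrange's identity for the Lorentzian cross product has the sign opposite to the Euclidean
     one, so the Lorentzian plane of [K] and [U] has a spacelike normal. *)
  transitivity (bil G K U * bil G K U - bil G K K * bil G U U).
    rewrite (orthonormal_bil K U) (orthonormal_bil K K) (orthonormal_bil U U).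
    by ring.
  by rewrite KU KK mul0r subr0 mulr1.
have Kn : bil G K n = 0 by rewrite bilC // nE vol_alt.
have Un : bil G U n = 0 by rewrite bilC // nE vol_cyc vol_alt.
have vn : vol G s K U n = 1 by rewrite -nE.
exact: NullFrame.
Qed.

End NullFrameFromTime.

(** * Smoothness of the fields entering the null frame *)

Section LorentzianManifold.
Variables (R : realType) (M : topologicalType) (at_ : smooth_atlas R M).
Variables (g : M -> 'M[R]_3) (o : M -> bool) (T : M -> 'rV[R]_3).
Hypotheses (lorentzian_g : lorentzian at_ g) (spinM : spin_manifold at_ g o T).
Local Notation smooth_fun := (smooth_fun at_).
Local Notation smooth_vf := (smooth_vf at_).
Local Notation smooth_form := (smooth_form at_).
Local Notation mfd_diff := (mfd_diff at_).

Lemma metric_trmx p : (g p)^T = g p.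
Proof. exact: (lorentzian_g.2 p).1. Qed.

Lemma local_frame p : exists (W : set M) (e : M -> 'M[R]_3),
  [/\ open W, W p, forall i, smooth_vf W (fun q => row i (e q)),
      forall q, W q -> e q *m g q *m (e q)^T = lorentz_gram R &
      forall q, W q -> positive (o q) (e q)].
Proof.
have [I [dom [e [h [[dom_open dom_cover] frames _ _ _]]]]] := spinM.
have [a ap] := dom_cover p; exists (dom a), (e a).
have [se ad] := frames a.
by split => // q aq; have [? ? _] := ad q aq.
Qed.

Lemma frame_at p : exists2 e : 'M[R]_3,
  e *m g p *m e^T = lorentz_gram R & positive (o p) e.
Proof. by have [W [e [_ Wp _ H1 H2]]] := local_frame p; exists (e p); auto. Qed.

Lemma metric_unitmx p : g p \in unitmx.
Proof. by have [e orth _] := frame_at p; exact: metric_unit orth. Qed.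

Lemma smooth_bil U X Y : open U -> smooth_vf U X -> smooth_vf U Y ->
  smooth_fun U (fun p => bil (g p) (X p) (Y p)).
Proof. exact: lorentzian_g.1. Qed.

Lemma smooth_form_ev U a X : open U -> smooth_form setT a -> smooth_vf U X ->
  smooth_fun U (fun p => ev (a p) (X p)).
Proof. by move=> oU Ha HX; have := Ha U X oU HX; rewrite setTI. Qed.

(** The coefficients of [X] in a local orthonormal frame are, up to sign, its products with the
    frame vectors. These are scalar functions, whereas the entries of [X p] depend on the chart
    chosen at [p]. *)
Lemma smooth_vf_frame X :
  (forall W e, open W -> (forall i, smooth_vf W (fun q => row i (e q))) ->
    (forall q, W q -> e q *m g q *m (e q)^T = lorentz_gram R) ->
    (forall q, W q -> positive (o q) (e q)) ->
    forall i, smooth_fun W (fun q => bil (g q) (X q) (row i (e q)))) ->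
  smooth_vf setT X.
Proof.
move=> H; apply: smooth_vf_local => p _.
have [W [e [oW Wp se orth pos]]] := local_frame p; exists W => //.
have Hi := H W e oW se orth pos.
apply: smooth_vf_eq oW _ (smooth_vfD oW (smooth_vfD oW (smooth_vfZ oW (Hi 0) (se 0))
  (smooth_vfZ oW (Hi 1) (se 1)))
  (smooth_vfZ oW (smooth_funN oW (Hi 2)) (se 2))) => q Wq.
by rewrite scaleNr -orthonormal_expand //; exact: orth.
Qed.

Lemma smooth_sharp a : smooth_form setT a -> smooth_vf setT (fun p => sharp (g p) (a p)).
Proof.
move=> Ha; apply: smooth_vf_frame => W e oW se orth pos i.
apply: smooth_fun_eq oW _ (smooth_form_ev oW Ha (se i)) => q Wq.
by rewrite bil_sharp //; [exact: metric_trmx|exact: metric_unitmx].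
Qed.

(** The products with an adapted frame are minors of those of [X] and [Y]. Neither the square root
    in the volume form nor the sign [o] has to be shown smooth. *)
Lemma smooth_normal_vec X Y : smooth_vf setT X -> smooth_vf setT Y ->
  smooth_vf setT (fun p => normal_vec (g p) (o p) (X p) (Y p)).
Proof.
move=> HX HY; apply: smooth_vf_frame => W e oW se orth pos.
have sX i : smooth_fun W (fun q => bil (g q) (X q) (row i (e q))) :=
  smooth_bil oW (smooth_vf_sub (@subsetT _ W) HX) (se i).
have sY i : smooth_fun W (fun q => bil (g q) (Y q) (row i (e q))) :=
  smooth_bil oW (smooth_vf_sub (@subsetT _ W) HY) (se i).
have minor i j : smooth_fun W (fun q =>
    bil (g q) (X q) (row i (e q)) * bil (g q) (Y q) (row j (e q)) -
    bil (g q) (X q) (row j (e q)) * bil (g q) (Y q) (row i (e q))).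
  by apply: smooth_funB => //; apply: smooth_funM.
have E1 q i : W q -> bil (g q) (normal_vec (g q) (o q) (X q) (Y q)) (row i (e q)) =
    vol (g q) (o q) (X q) (Y q) (row i (e q)).
  by move=> Wq; rewrite (bil_normal_vec _ (metric_trmx q) (orth q Wq)).
apply: forall3;
  [apply: smooth_fun_eq oW _ (minor 2 1)|apply: smooth_fun_eq oW _ (minor 0 2)
  |apply: smooth_fun_eq oW _ (minor 0 1)] => q Wq; rewrite E1 //;
  have [V0 V1 V2] := vol_orthonormal (orth q Wq) (pos q Wq) (X q) (Y q);
  rewrite ?V0 ?V1 ?V2; reflexivity.
Qed.

Lemma smooth_null_partner U : smooth_vf setT T -> smooth_vf setT U ->
  (forall p, bil (g p) (T p) (U p) != 0) ->
  smooth_vf setT (fun p => null_partner (g p) (T p) (U p)).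
Proof.
move=> sT sU mu0; have oT := @openT M.
have sTU := smooth_bil oT sT sU; have sTT := smooth_bil oT sT sT.
have sV := smooth_funV oT (fun p _ => mu0 p) sTU.
have s2V : smooth_fun setT (fun p => (2 * bil (g p) (T p) (U p))^-1).
  apply: (smooth_funV oT); last exact: (smooth_funM oT (smooth_fun_cst _ 2) sTU).
  by move=> p _; rewrite mulf_neq0 // pnatr_eq0.
exact: (smooth_vfZ oT sV
  (smooth_vf_lin oT (smooth_funN oT (smooth_funM oT sTT s2V)) sU sT)).
Qed.

(** The contorsion enters both implications in this form, as a triple product free of the Hodge
    star. *)
Lemma bil_contorsion l chi p w x y :
  bil (g p) x (contorsion g o l chi p w y) =
  l * vol (g p) (o p) (sharp (g p) (first_entry chi p w)) y x.
Proof.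
have sg := metric_trmx p; have ug := metric_unitmx p.
by rewrite (bilC sg) /contorsion (bil_sharp sg ug) (hodge_star2E _ sg ug) !evZl.
Qed.

End LorentzianManifold.

(** * The trivial bundle of rank two *)

Section TrivialBundle.
Variables (R : realType) (M : topologicalType) (at_ : smooth_atlas R M).

Definition std_frame : 2.-tuple 'rV[R]_2 := [tuple (delta_mx 0 i : 'rV[R]_2) | i < 2].

Lemma std_frame_sum (v : 'rV[R]_2) : v = \sum_i v 0 i *: std_frame`_i.
Proof.
rewrite {1}(row_sum_delta v); apply: eq_bigr => i _.
by rewrite -tnth_nth tnth_mktuple.
Qed.

Lemma std_frame_basis : basis_of fullv std_frame.
Proof.
rewrite basisEdim size_tuple dimvf leqnn andbT.
apply/subvP => v _; rewrite (std_frame_sum v).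
by apply: memv_suml => i _; apply: memvZ; apply: memv_span; apply: mem_nth; rewrite size_tuple.
Qed.

Lemma coord_std_frame i (v : 'rV[R]_2) : coord std_frame i v = v 0 i.
Proof.
rewrite {1}(std_frame_sum v) coord_sum_free //.
exact: basis_free std_frame_basis.
Qed.

Lemma std_frame_transition (a b : unit) (i j : 'I_2) :
  smooth_fun at_ (setT `&` setT) (fun p : M => coord std_frame i (tnth std_frame j)).
Proof. exact: smooth_fun_cst. Qed.

Definition trivial_bundle : vector_bundle at_ 2 :=
  @VectorBundle R M at_ 2 (fun _ => 'rV[R]_2 : vectType R) unit (fun _ => setT)
    (fun _ _ => std_frame) (fun _ => openT) (fun p => ex_intro _ tt I)
    (fun _ _ _ => std_frame_basis) std_frame_transition.

Lemma smooth_sec_trivial (U : set M) (s : forall p, trivial_bundle p) :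
  smooth_sec U s <-> forall i, smooth_fun at_ U (fun p => (s p : 'rV[R]_2) 0 i).
Proof.
split=> H.
- move=> i; have := H tt i; rewrite /= setIT.
  by rewrite (_ : (fun p => coord _ i (s p)) = (fun p => (s p : 'rV[R]_2) 0 i)) //;
    apply/funext => p; rewrite coord_std_frame.
- move=> a i; rewrite /= setIT.
  by rewrite (_ : (fun p => coord _ i (s p)) = (fun p => (s p : 'rV[R]_2) 0 i)) //;
    apply/funext => p; rewrite coord_std_frame.
Qed.

End TrivialBundle.

(** * The paired spinor bundle attached to a null frame, and its spinor *)

Section NullFrameSpinors.
Variables (R : realType) (M : topologicalType) (at_ : smooth_atlas R M).
Variables (g : M -> 'M[R]_3) (o : M -> bool) (T : M -> 'rV[R]_3).
Hypotheses (lorentzian_g : lorentzian at_ g) (spinM : spin_manifold at_ g o T).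
Variables (l : R) (nablag : tangent_cov R M).
Hypotheses (l2 : l * l = 1) (metric_nablag : metric_connection at_ g nablag).
Variables (K U n : M -> 'rV[R]_3).
Hypotheses (smooth_K : smooth_vf at_ setT K) (smooth_U : smooth_vf at_ setT U)
  (smooth_n : smooth_vf at_ setT n)
  (nf : forall p, null_frame (g p) (o p) (K p) (U p) (n p)).
Local Notation smooth_fun := (smooth_fun at_).
Local Notation smooth_vf := (smooth_vf at_).
Local Notation smooth_form := (smooth_form at_).
Local Notation mfd_diff := (mfd_diff at_).
Local Notation S0 := (trivial_bundle at_).
Let symg := metric_trmx lorentzian_g.
Let unitg := metric_unitmx spinM.
Let oT : open [set: M] := openT.

Definition frame_clifford (p : M) (a : 'cV[R]_3) : 'End('rV[R]_2) :=
  linfun (mulmxr (clifford_mx l (K p) (U p) (n p) a)).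

Lemma frame_cliffordE p a s :
  frame_clifford p a s = s *m clifford_mx l (K p) (U p) (n p) a.
Proof. by rewrite /frame_clifford lfunE. Qed.

Lemma frame_clifford_linear p k a b :
  frame_clifford p (k *: a + b) = k *: frame_clifford p a + frame_clifford p b.
Proof.
apply/lfunP => s; rewrite add_lfunE scale_lfunE !frame_cliffordE clifford_mx_linear.
by rewrite mulmxDr scalemxAr.
Qed.

Lemma frame_clifford_entry p a s :
  (frame_clifford p a s 0 0 =
     s 0 0 * (l * ev a (n p)) + s 0 1 * (2 * ev a (K p))) *
  (frame_clifford p a s 0 1 = s 0 0 * ev a (U p) - s 0 1 * (l * ev a (n p))).
Proof. by rewrite frame_cliffordE !mxE !sum2 !mxE /= mulrN. Qed.

(** The area form: an endomorphism of the plane is skew for it exactly when it is traceless, as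
    every [clifford_mx] is. *)
Definition frame_pairing (p : M) (s t : 'rV[R]_2) : R := s 0 0 * t 0 1 - s 0 1 * t 0 0.

Lemma rV2P (s t : 'rV[R]_2) : s 0 0 = t 0 0 -> s 0 1 = t 0 1 -> s = t.
Proof. by move=> H0 H1; apply/rowP; exact: forall2. Qed.

Lemma frame_clifford_smooth W a s : open W -> smooth_form W a ->
  (forall i, smooth_fun W (fun p => (s p : 'rV[R]_2) 0 i)) ->
  forall i, smooth_fun W (fun p => frame_clifford p (a p) (s p) 0 i).
Proof.
move=> oW Ha Hs.
have ea X : smooth_vf setT X -> smooth_fun W (fun p => ev (a p) (X p)).
  by move=> HX; have := Ha setT X oT HX; rewrite setIT.
have ln : smooth_fun W (fun p => l * ev (a p) (n p)).
  by apply: smooth_funM => //; [exact: smooth_fun_cst|exact: ea].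
apply: forall2.
- have H : smooth_fun W (fun p => s p 0 0 * (l * ev (a p) (n p)) +
      s p 0 1 * (2 * ev (a p) (K p))).
    apply: smooth_funD => //; apply: smooth_funM => //.
    by apply: smooth_funM => //; [exact: smooth_fun_cst|exact: ea].
  by apply: smooth_fun_eq oW _ H => p _; rewrite frame_clifford_entry.
- have H : smooth_fun W (fun p => s p 0 0 * ev (a p) (U p) -
      s p 0 1 * (l * ev (a p) (n p))).
    apply: smooth_funB => //; apply: smooth_funM => //.
    exact: ea.
  by apply: smooth_fun_eq oW _ H => p _; rewrite frame_clifford_entry.
Qed.

(** Ladder argument: the dual of [U] sends any vector with nonzero second coordinate to a nonzero
    multiple of the first basis vector, and the dual of [K] sends the first basis vector to the
    second. *)
Lemma frame_clifford_irreducible p (V : {vspace 'rV[R]_2}) :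
  (forall a, (frame_clifford p a @: V <= V)%VS) -> V = 0%VS \/ V = fullv.
Proof.
move=> inv; have [->|V0] := eqVneq V 0%VS; [by left|right].
have invV a s : s \in V -> frame_clifford p a s \in V.
  by move=> sV; apply: (subvP (inv a)); exact: memv_img.
have [KK UU nn KU Kn Un _] := nf p.
have e0V : (delta_mx 0 0 : 'rV[R]_2) \in V.
  have xV := memv_pick V; have x0 : vpick V != 0 by rewrite vpick0.
  have [y0|y0] := eqVneq (vpick V 0 1) 0.
    have z0 : vpick V 0 0 != 0.
      apply: contra_neq x0 => z0; apply: rV2P; by rewrite ?z0 ?y0 mxE.
    have -> : delta_mx 0 0 = (vpick V 0 0)^-1 *: vpick V.
      by apply: rV2P; rewrite !mxE /= ?mulVf // y0 mulr0.
    exact: memvZ.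
  have -> : delta_mx 0 0 = (2 * vpick V 0 1)^-1 *:
      frame_clifford p (flat (g p) (U p)) (vpick V).
    apply: rV2P; rewrite !mxE /= !frame_clifford_entry !(ev_flat (symg p)) ?UU ?Un.
      by rewrite (bilC (symg p) (U p)) KU; field.
    by rewrite !mulr0 subrr mulr0.
  by apply: memvZ; exact: invV.
have e1V : (delta_mx 0 1 : 'rV[R]_2) \in V.
  have -> : delta_mx 0 1 = frame_clifford p (flat (g p) (K p)) (delta_mx 0 0).
    apply: rV2P; rewrite !frame_clifford_entry !(ev_flat (symg p)) ?KK ?Kn ?KU !mxE /=; ring.
  exact: invV.
apply/vspaceP => v; rewrite memvf (row_sum_delta v) sum2.
by apply: memvD; apply: memvZ.
Qed.

Lemma frame_irreducible_clifford :
  irreducible_clifford (S := S0) g o l frame_clifford.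
Proof.
split.
- exact: frame_clifford_linear.
- move=> W a s oW Ha /smooth_sec_trivial Hs; apply/smooth_sec_trivial.
  exact: frame_clifford_smooth.
- move=> p a; apply/lfunP => s.
  rewrite comp_lfunE scale_lfunE id_lfunE !frame_cliffordE -mulmxA.
  by rewrite (clifford_mx_sqr (symg p) (unitg p) (nf p) _ l2) mul_mx_scalar.
- exact: frame_clifford_irreducible.
- move=> p E orthE posE; apply/lfunP => s.
  rewrite !comp_lfunE scale_lfunE id_lfunE !frame_cliffordE.
  rewrite -!mulmxA [X in s *m X]mulmxA.
  by rewrite (clifford_coframe (symg p) (unitg p) (nf p) l2 orthE posE) mul_mx_scalar.
Qed.

Lemma frame_spinor_pairing : spinor_pairing (S := S0) frame_clifford frame_pairing.
Proof.
split.
- by move=> p k x y z; rewrite /frame_pairing !mxE; ring.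
- by move=> p x y; rewrite /frame_pairing; ring.
- move=> p x H; apply: rV2P; rewrite mxE.
    by have := H (delta_mx 0 1); rewrite /frame_pairing !mxE /= mulr1 mulr0 subr0.
  have := H (delta_mx 0 0); rewrite /frame_pairing !mxE /= mulr1 mulr0 sub0r.
  by move/eqP; rewrite oppr_eq0 => /eqP.
- move=> W s t oW /smooth_sec_trivial Hs /smooth_sec_trivial Ht.
  by apply: smooth_funB => //; apply: smooth_funM.
- by move=> p a x y; rewrite /frame_pairing !frame_clifford_entry; ring.
Qed.

Definition coefKU p v := bil (g p) (nablag p v K) (U p).
Definition coefUn p v := bil (g p) (nablag p v U) (n p).
Definition coefKn p v := bil (g p) (nablag p v K) (n p).

(* The coefficients are forced by the parallelism of [Gamma], as [K], [U] and [n]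
   have constant scalar products. *)
Definition frame_nabla (p : M) (v : 'rV[R]_3) (s : M -> 'rV[R]_2) : 'rV[R]_2 :=
  \row_i mfd_diff (fun q => s q 0 i) p v +
  s p *m \matrix_(i < 2, j < 2)
    (if i == 0 then (if j == 0 then - (coefKU p v / 2) else - (l * coefUn p v / 2))
     else (if j == 0 then l * coefKn p v else coefKU p v / 2)).

Lemma frame_nabla_entry p v s :
  (frame_nabla p v s 0 0 = mfd_diff (fun q => s q 0 0) p v +
     (s p 0 0 * - (coefKU p v / 2) + s p 0 1 * (l * coefKn p v))) *
  (frame_nabla p v s 0 1 = mfd_diff (fun q => s q 0 1) p v +
     (s p 0 0 * - (l * coefUn p v / 2) + s p 0 1 * (coefKU p v / 2))).
Proof. by rewrite /frame_nabla !mxE !sum2 !mxE. Qed.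

Lemma nabla_linear p k v w X : smooth_vf setT X ->
  nablag p (k *: v + w) X = k *: nablag p v X + nablag p w X.
Proof. by case: metric_nablag => -[H _ _ _] _; exact: H. Qed.

Lemma nabla_smooth W X Y : open W -> smooth_vf W X -> smooth_vf setT Y ->
  smooth_vf W (fun p => nablag p (X p) Y).
Proof.
move=> oW HX HY; case: metric_nablag => -[_ _ _ H] _.
exact: (H _ _ _ oW HX (smooth_vf_sub (@subsetT _ W) HY)).
Qed.

Lemma nabla_bil_const X Y (c : R) p v : smooth_vf setT X -> smooth_vf setT Y ->
  (forall q, bil (g q) (X q) (Y q) = c) ->
  bil (g p) (nablag p v X) (Y p) + bil (g p) (nablag p v Y) (X p) = 0.
Proof.
move=> HX HY HXY; case: metric_nablag => _ H.
rewrite (bilC (symg p) (nablag p v Y)) -(H setT) //.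
by rewrite (mfd_diff_eq _ oT _ _ (fun q _ => HXY q)) // mfd_diff_cst.
Qed.

Lemma nabla_frame p v :
  [/\ bil (g p) (nablag p v K) (K p) = 0, bil (g p) (nablag p v U) (U p) = 0,
      bil (g p) (nablag p v n) (n p) = 0,
      bil (g p) (nablag p v U) (K p) = - coefKU p v &
      (bil (g p) (nablag p v n) (U p) = - coefUn p v) /\
      (bil (g p) (nablag p v n) (K p) = - coefKn p v)].
Proof.
have KK := nabla_bil_const p v smooth_K smooth_K (fun q => null_frameKK (nf q)).
have UU := nabla_bil_const p v smooth_U smooth_U (fun q => null_frameUU (nf q)).
have nn := nabla_bil_const p v smooth_n smooth_n (fun q => null_framenn (nf q)).
have KU := nabla_bil_const p v smooth_K smooth_U (fun q => null_frameKU (nf q)).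
have Un := nabla_bil_const p v smooth_U smooth_n (fun q => null_frameUn (nf q)).
have Kn := nabla_bil_const p v smooth_K smooth_n (fun q => null_frameKn (nf q)).
rewrite /coefKU /coefUn /coefKn; split; [lra|lra|lra|lra|split; lra].
Qed.

Lemma bil_nabla_frame p v x :
  [/\ bil (g p) x (nablag p v K) =
        coefKU p v * bil (g p) x (K p) + coefKn p v * bil (g p) x (n p),
      bil (g p) x (nablag p v U) =
        - (coefKU p v * bil (g p) x (U p)) + coefUn p v * bil (g p) x (n p) &
      bil (g p) x (nablag p v n) =
        - (coefUn p v * bil (g p) x (K p)) - coefKn p v * bil (g p) x (U p)].
Proof.
have [KK UU nn UK [nU nK]] := nabla_frame p v.
split; rewrite (null_frame_bil (symg p) (nf p)) ?KK ?UU ?nn ?UK ?nU ?nK;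
  rewrite -?/(coefKU p v) -?/(coefUn p v) -?/(coefKn p v); ring.
Qed.

Lemma nabla_bil W p X Y v : open W -> W p -> smooth_vf W X -> smooth_vf setT Y ->
  mfd_diff (fun q => bil (g q) (X q) (Y q)) p v =
  bil (g p) (nablag p v X) (Y p) + bil (g p) (X p) (nablag p v Y).
Proof.
move=> oW Wp HX HY; case: metric_nablag => _ H.
exact: (H _ _ _ _ _ oW Wp HX (smooth_vf_sub (@subsetT _ W) HY)).
Qed.

Lemma frame_nabla_linear W p (s : M -> 'rV[R]_2) k v w : W p ->
  (forall i, smooth_fun W (fun q => s q 0 i)) ->
  frame_nabla p (k *: v + w) s = k *: frame_nabla p v s + frame_nabla p w s.
Proof.
move=> Wp Hs; apply: rV2P; rewrite [in RHS]mxE [X in _ = X + _]mxE !frame_nabla_entry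
  (mfd_diff_linear Wp _ _ _ (Hs _)) /coefKU /coefKn /coefUn
  ?(nabla_linear _ _ _ _ smooth_K) ?(nabla_linear _ _ _ _ smooth_U) !bilDl; ring.
Qed.

Lemma frame_nabla_connection :
  is_connection at_ (F := fun p => S0 p) (smooth_sec (S := S0)) frame_nabla.
Proof.
split.
- move=> W p s k v w oW Wp /smooth_sec_trivial Hs.
  exact: frame_nabla_linear Wp Hs.
- move=> W p s t v oW Wp /smooth_sec_trivial Hs /smooth_sec_trivial Ht.
  have E1 i : mfd_diff (fun q => (s q + t q) 0 i) p v =
      mfd_diff (fun q => s q 0 i) p v + mfd_diff (fun q => t q 0 i) p v.
    by rewrite -(mfd_diffD Wp) //; apply: (mfd_diff_eq _ oW Wp) => q _; rewrite mxE.
  by apply: rV2P; rewrite [in RHS]mxE !frame_nabla_entry !E1 ![(s p + t p) _ _]mxE; ring.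
- move=> W p f s v oW Wp Hf /smooth_sec_trivial Hs.
  have E1 i : mfd_diff (fun q => (f q *: s q) 0 i) p v =
      mfd_diff f p v * s p 0 i + f p * mfd_diff (fun q => s q 0 i) p v.
    by rewrite -(mfd_diffM Wp) //; apply: (mfd_diff_eq _ oW Wp) => q _; rewrite mxE.
  have E2 i : (f p *: s p) 0 i = f p * s p 0 i by rewrite mxE.
  by apply: rV2P; rewrite [RHS]mxE [X in _ = X + _]mxE [X in _ = _ + X]mxE
    !frame_nabla_entry !E1 !E2; ring.
- move=> W X s oW HX /smooth_sec_trivial Hs; apply/smooth_sec_trivial.
  have sub Y : smooth_vf setT Y -> smooth_vf W Y by exact: smooth_vf_sub.
  have sc Y Z : smooth_vf setT Y -> smooth_vf setT Z ->
      smooth_fun W (fun p => bil (g p) (nablag p (X p) Y) (Z p)).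
    by move=> HY HZ; exact: (smooth_bil lorentzian_g oW (nabla_smooth oW HX HY) (sub _ HZ)).
  have cst k : smooth_fun W (fun _ => k) by exact: smooth_fun_cst.
  apply: forall2.
  + have H : smooth_fun W (fun p => mfd_diff (fun q => (s q : 'rV[R]_2) 0 0) p (X p) +
      ((s p : 'rV[R]_2) 0 0 * - (coefKU p (X p) / 2) +
       (s p : 'rV[R]_2) 0 1 * (l * coefKn p (X p)))).
      apply: smooth_funD => //; first exact: smooth_fun_mfd_diff.
      apply: smooth_funD => //; apply: smooth_funM => //.
        by apply: smooth_funN => //; apply: smooth_funM => //; exact: sc.
      by apply: smooth_funM => //; exact: sc.
    by apply: smooth_fun_eq oW _ H => p _; rewrite frame_nabla_entry.
  + have H : smooth_fun W (fun p => mfd_diff (fun q => (s q : 'rV[R]_2) 0 1) p (X p) +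
      ((s p : 'rV[R]_2) 0 0 * - (l * coefUn p (X p) / 2) +
       (s p : 'rV[R]_2) 0 1 * (coefKU p (X p) / 2))).
      apply: smooth_funD => //; first exact: smooth_fun_mfd_diff.
      apply: smooth_funD => //; apply: smooth_funM => //.
        apply: smooth_funN => //; apply: smooth_funM => //.
        by apply: smooth_funM => //; exact: sc.
      by apply: smooth_funM => //; exact: sc.
    by apply: smooth_fun_eq oW _ H => p _; rewrite frame_nabla_entry.
Qed.

Lemma frame_nabla_clifford W p X (s : M -> 'rV[R]_2) v : open W -> W p ->
  smooth_vf W X -> (forall i, smooth_fun W (fun q => s q 0 i)) ->
  frame_nabla p v (fun q => frame_clifford q (flat (g q) (X q)) (s q)) =
  frame_clifford p (flat (g p) (nablag p v X)) (s p) +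
  frame_clifford p (flat (g p) (X p)) (frame_nabla p v s).
Proof.
move=> oW Wp HX Hs.
have sub Y : smooth_vf setT Y -> smooth_vf W Y by exact: smooth_vf_sub.
have sK : smooth_fun W (fun q => bil (g q) (X q) (K q)).
  exact: (smooth_bil lorentzian_g oW HX (sub _ smooth_K)).
have sU : smooth_fun W (fun q => bil (g q) (X q) (U q)).
  exact: (smooth_bil lorentzian_g oW HX (sub _ smooth_U)).
have sn : smooth_fun W (fun q => bil (g q) (X q) (n q)).
  exact: (smooth_bil lorentzian_g oW HX (sub _ smooth_n)).
have cst k : smooth_fun W (fun _ => k) by exact: smooth_fun_cst.
have D0 : mfd_diff (fun q => frame_clifford q (flat (g q) (X q)) (s q) 0 0) p v =
    mfd_diff (fun q => s q 0 0 * (l * bil (g q) (X q) (n q)) +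
                       s q 0 1 * (2 * bil (g q) (X q) (K q))) p v.
  apply: (mfd_diff_eq _ oW Wp) => q _.
  by rewrite frame_clifford_entry !(ev_flat (symg q)).
have D1 : mfd_diff (fun q => frame_clifford q (flat (g q) (X q)) (s q) 0 1) p v =
    mfd_diff (fun q => s q 0 0 * bil (g q) (X q) (U q) +
                       - (s q 0 1 * (l * bil (g q) (X q) (n q)))) p v.
  apply: (mfd_diff_eq _ oW Wp) => q _.
  by rewrite frame_clifford_entry !(ev_flat (symg q)).
have [BK BU Bn] := bil_nabla_frame p v (X p).
have sln : smooth_fun W (fun q => l * bil (g q) (X q) (n q)) by exact: smooth_funM.
have s2K : smooth_fun W (fun q => 2 * bil (g q) (X q) (K q)) by exact: smooth_funM.
rewrite (mfd_diffD Wp) ?(mfd_diffM Wp) // ?(mfd_diffMl Wp) // in D0; try exact: smooth_funM.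
rewrite (mfd_diffD Wp) ?(mfd_diffN oW Wp) ?(mfd_diffM Wp) // ?(mfd_diffMl Wp) // in D1;
  try exact: smooth_funM;
  try (by apply: smooth_funN => //; exact: smooth_funM).
apply: rV2P; rewrite [in RHS]mxE !frame_nabla_entry ?D0 ?D1 !frame_clifford_entry
  !frame_nabla_entry !(ev_flat (symg p)) !(nabla_bil v oW Wp HX) // ?BK ?BU ?Bn
  ?mfd_diff_cst.
- move: (bil _ (nablag p v X) (n p)) (bil _ (nablag p v X) (K p)) (mfd_diff _ p v)
    (mfd_diff _ p v) (bil _ _ (U p)) (bil _ _ (K p)) (bil _ _ (n p)) (coefKU p v)
    (coefUn p v) (coefKn p v) (s p 0 0) (s p 0 1) => dn dK d0 d1 xU xK xn a b c s0 s1.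
  apply/eqP; rewrite -subr_eq0; apply/eqP.
  (* Where an [l] of the Clifford matrix meets an [l] of the connection matrix, a factor [l * l]
     remains; it faces terms without [l], and the difference is a multiple of [1 - l * l]. *)
  transitivity ((1 - l * l) * (2 * s1 * c * xn)); last by rewrite l2 subrr mul0r.
  by field.
- move: (bil _ (nablag p v X) (n p)) (bil _ (nablag p v X) (U p)) (mfd_diff _ p v)
    (mfd_diff _ p v) (bil _ _ (U p)) (bil _ _ (K p)) (bil _ _ (n p)) (coefKU p v)
    (coefUn p v) (coefKn p v) (s p 0 0) (s p 0 1) => dn dU d0 d1 xU xK xn a b c s0 s1.
  apply/eqP; rewrite -subr_eq0; apply/eqP.
  transitivity ((1 - l * l) * (s0 * b * xn)); last by rewrite l2 subrr mul0r.
  by field.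
Qed.

Lemma frame_spin_lift : spin_lift (S := S0) g nablag frame_clifford frame_pairing frame_nabla.
Proof.
split; first exact: frame_nabla_connection.
- move=> W p X s v oW Wp HX /smooth_sec_trivial Hs.
  exact: (frame_nabla_clifford v oW Wp HX Hs).
- move=> W p s t v oW Wp /smooth_sec_trivial Hs /smooth_sec_trivial Ht.
  rewrite /frame_pairing (mfd_diffD Wp) ?(mfd_diffN oW Wp) ?(mfd_diffM Wp) //;
    try exact: smooth_funM; last by apply: smooth_funN => //; exact: smooth_funM.
  by rewrite !frame_nabla_entry; ring.
Qed.

Variables (theta : M -> 'cV[R]_3) (chi : M -> 'M[R]_3) (D : tangent_cov R M).
Hypotheses (smooth_theta : smooth_form setT theta) (smooth_chi : smooth_bilinear at_ chi)
  (contorsion_D : has_contorsion at_ nablag D (contorsion g o l chi))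
  (recurrent_U : recurrent_form at_ D theta (fun p => flat (g p) (U p))).

(** The recurrence is evaluated on [K] and on [n], where [u] is constantly [1] and [0], so the
    derivative term drops out. On [U] it would be trivial, all its terms being zero. *)
Lemma frame_recurrence p v :
  [/\ coefKU p v = - (ev (theta p) v + l * ev (first_entry chi p v) (n p)) &
      coefUn p v = - (l * ev (first_entry chi p v) (U p))].
Proof.
have rec Y c : smooth_vf setT Y -> (forall q, bil (g q) (U q) (Y q) = c) ->
    - (bil (g p) (nablag p v Y) (U p) +
       l * vol (g p) (o p) (sharp (g p) (first_entry chi p v)) (Y p) (U p)) =
    ev (theta p) v * c.
  move=> HY HUY; have := @recurrent_U setT p v Y oT I HY.
  rewrite (@mfd_diff_eq _ _ _ _ p oT I _ (fun=> c)); last first.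
    by move=> q _; rewrite (ev_flat (symg q)).
  rewrite mfd_diff_cst sub0r (@contorsion_D setT p v Y oT I HY) !(ev_flat (symg p)) HUY.
  by rewrite bil_addr (bil_contorsion lorentzian_g spinM) (bilC (symg p) (U p)).
have [KK UU nn UK [nU nK]] := nabla_frame p v.
have [VK VU Vn] := null_frame_vols (symg p) (nf p)
  (sharp (g p) (first_entry chi p v)) (K p).
have [WK WU Wn] := null_frame_vols (symg p) (nf p)
  (sharp (g p) (first_entry chi p v)) (n p).
have [FKK FUU Fnn FKU FKn FUn _] := nf p.
have RK := rec K 1 smooth_K (fun q => etrans (bilC (symg q) _ _) (null_frameKU (nf q))).
have Rn := rec n 0 smooth_n (fun q => null_frameUn (nf q)).
move: RK Rn; rewrite VU WU nU !(bil_sharp (symg p) (unitg p)) -/(coefKU p v).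
rewrite FKU FKn Fnn (bilC (symg p) (n p)) FUn.
by split; lra.
Qed.

Definition frame_endo (p : M) (w : 'rV[R]_3) : 'End('rV[R]_2) :=
  (2^-1 * ev (theta p) w) *: \1%VF + frame_clifford p (2^-1 *: first_entry chi p w).

Lemma ev_first_entry p w v : ev (first_entry chi p w) v = bil (chi p) w v.
Proof. by rewrite /first_entry /ev /bil -[v in LHS]trmxK -trmx_mul mxE. Qed.

Lemma frame_endoE p w s : frame_endo p w s =
  (2^-1 * ev (theta p) w) *: s + frame_clifford p (2^-1 *: first_entry chi p w) s.
Proof. by rewrite /frame_endo add_lfunE scale_lfunE id_lfunE. Qed.

Lemma frame_endo_linear p k v w :
  frame_endo p (k *: v + w) = k *: frame_endo p v + frame_endo p w.
Proof.
have chiD : 2^-1 *: first_entry chi p (k *: v + w) =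
    k *: (2^-1 *: first_entry chi p v) + 2^-1 *: first_entry chi p w.
  by rewrite /first_entry mulmxDl -scalemxAl linearP scalerDr !scalerA mulrC.
rewrite /frame_endo chiD frame_clifford_linear evDr mulrDr scalerDl mulrCA -(scalerA k).
by rewrite scalerDr addrACA.
Qed.

Theorem recurrent_null_frame_spinor :
  exists (S : vector_bundle at_ 2) (Gam : forall p, 'cV[R]_3 -> 'End(S p))
    (B : forall p, S p -> S p -> R) (nablaS : spinor_cov S)
    (A : forall p, 'rV[R]_3 -> 'End(S p)) (eps : forall p, S p),
    [/\ paired_spinor_bundle g o l Gam B, spin_lift g nablag Gam B nablaS,
      endo_form A /\ has_dequantization Gam A (half_sum theta chi),
      differential_spinor nablaS A eps & forall p, eps p <> 0].
Proof.
exists S0, frame_clifford, frame_pairing, frame_nabla, frame_endo, (fun _ => delta_mx 0 0).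
split.
- by split; [exact: frame_irreducible_clifford|exact: frame_spinor_pairing].
- exact: frame_spin_lift.
(* [frame_endo] is by definition the quantization of [half_sum theta chi]. *)
- split; last by [].
  split; first exact: frame_endo_linear.
  move=> W X s oW HX /smooth_sec_trivial Hs; apply/smooth_sec_trivial.
  have Hc i : smooth_fun W (fun p =>
      frame_clifford p (2^-1 *: first_entry chi p (X p)) (s p) 0 i).
    apply: frame_clifford_smooth => // V Y oV HY.
    have oWV : open (W `&` V) by exact: openI.
    have Hb : smooth_fun (W `&` V) (fun p => 2^-1 * bil (chi p) (X p) (Y p)).
      apply: smooth_funM => //; first exact: smooth_fun_cst.
      exact: (smooth_chi oWV (smooth_vf_sub (@subIsetl _ _ _) HX)
        (smooth_vf_sub (@subIsetr _ _ _) HY)).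
    by apply: smooth_fun_eq oWV _ Hb => p _; rewrite evZl ev_first_entry.
  move=> i; have H : smooth_fun W (fun p => 2^-1 * ev (theta p) (X p) *
      (s p : 'rV[R]_2) 0 i +
      frame_clifford p (2^-1 *: first_entry chi p (X p)) (s p) 0 i).
    apply: smooth_funD => //; apply: smooth_funM => //.
    apply: smooth_funM => //; first exact: smooth_fun_cst.
    exact: smooth_form_ev.
  by apply: smooth_fun_eq oW _ H => p _; rewrite frame_endoE !mxE.
- split.
    by apply/smooth_sec_trivial => i; exact: smooth_fun_cst.
  move=> p w; rewrite frame_endoE.
  have [EK EU] := frame_recurrence p w.
  apply: rV2P; rewrite !frame_nabla_entry ?EK ?EU mfd_diff_cst [RHS]mxE
    [X in _ = X + _]mxE !frame_clifford_entry !evZl !mxE /=.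
    by rewrite !mul0r !mul1r !addr0; lra.
  (* Second coordinate: the connection gives [- l coefUn / 2], which is [l * l] times
     [chi_w(U) / 2], and the endomorphism gives [chi_w(U) / 2]. *)
  have := congr1 ( *%R^~ (ev (first_entry chi p w) (U p))) l2.
  by rewrite /= mul1r; lra.
- by move=> p /matrixP/(_ 0 0)/eqP; rewrite !mxE /= oner_eq0.
Qed.

End NullFrameSpinors.

(** * Uniqueness for linear differential systems *)

Section LinearODE.
Variable R : realType.
Local Notation E := 'rV[R]_3.

(** The function [expR (- C * t) * F t] has nonpositive derivative and starts at zero. *)
Lemma gronwall_zero (F : R -> R) (C : R) :
  (forall t : R, 0 <= t <= 1 -> derivable F t 1) ->
  (forall t : R, 0 <= t <= 1 -> 'D_1 F t <= C * F t) -> F 0 = 0 -> F 1 <= 0.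
Proof.
move=> dF leF F0.
pose G (t : R) := expR (- C * t) * F t.
have dexp (t : R) : is_derive t 1 (fun t => expR (- C * t)) (- C * expR (- C * t)).
  apply: is_derive_eq; by rewrite scaler1 [LHS]mulrC.
have dG (t : R) : 0 <= t <= 1 ->
    is_derive t 1 G (expR (- C * t) * ('D_1 F t - C * F t)).
  move=> t01; have dFt := derivableP (dF t t01).
  have H := is_deriveM (dexp t) dFt.
  apply: is_derive_eq H _; rewrite /GRing.scale /=; ring.
suff : G 1 <= G 0.
  by rewrite /G F0 mulr0 pmulr_rle0 // expR_gt0.
apply: (@ler0_derive1_nincr _ G 0 1) => //.
- move=> t; rewrite in_itv /= => /andP[t0 t1].
  have H : 0 <= t <= 1 by rewrite !ltW.
  by have [] := dG t H.
- move=> t; rewrite in_itv /= => /andP[t0 t1].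
  have H : 0 <= t <= 1 by rewrite !ltW.
  rewrite derive1E; have [_ ->] := dG t H.
  by rewrite pmulr_rle0 ?expR_gt0 // subr_le0; exact: leF.
- apply: derivable_within_continuous => t; rewrite in_itv /= => H.
  by have [] := dG t H.
Qed.

Lemma derive_line (f : E -> R) (x h : E) (t : R) :
  differentiable (f : E -> R^o) (x + t *: h) ->
  is_derive t 1 (fun s : R => f (x + s *: h)) ('D_h (f : E -> R^o) (x + t *: h)).
Proof.
move=> df; pose c (s : R) := x + s *: h.
have dc : is_diff t c ( *:%R^~ h).
  have H1 : is_diff t (fun s : R => s *: h) ( *:%R^~ h) by exact: is_diff_scalel.
  have := is_diffD (is_diff_cst x t) H1.
  by move=> H; apply: is_diff_eq H _; apply/funext => s; rewrite !fctE add0r.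
have [cdiff dcE] := dc.
have dfc : differentiable (f \o c : R -> R^o) t by exact: differentiable_comp.
apply: DeriveDef; first exact: diff_derivable.
rewrite (_ : (fun s => f (x + s *: h)) = f \o c) // deriveE // diff_comp //=.
by rewrite dcE scale1r deriveE.
Qed.

(* Gronwall's inequality for [t |-> |f (x0 + t (x - x0))|^2] on [[0, 1]]. *)
Lemma linear_system_zero (O : set E) (f : 'I_2 -> E -> R)
    (w : 'I_3 -> 'I_2 -> 'I_2 -> E -> R) (x0 : E) :
  open O -> O x0 ->
  (forall j x, O x -> differentiable (f j : E -> R^o) x) ->
  (forall k i j, {for x0, continuous (w k i j)}) ->
  (forall k j x, O x -> 'D_(delta_mx 0 k) (f j : E -> R^o) x =
     \sum_i f i x * w k i j x) ->
  (forall j, f j x0 = 0) ->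
  \forall x \near x0, forall j, f j x = 0.
Proof.
move=> oO Ox0 df cw eqf f0.
(* Summing over all indices gives one bound for every coefficient; the summand [1] leaves room for
   the variation of each [w k i j] near [x0]. *)
pose C : R := \sum_k \sum_i \sum_j (`|w k i j x0| + 1).
have leC k i j : `|w k i j x0| + 1 <= C.
  have le_sum m (F : 'I_m -> R) a : (forall i, 0 <= F i) -> F a <= \sum_i F i.
    by move=> F0; rewrite (bigD1 a) //= lerDl sumr_ge0.
  have pos k' i' j' : 0 <= `|w k' i' j' x0| + 1 by rewrite addr_ge0.
  apply: le_trans (le_sum _ (fun j => `|w k i j x0| + 1) j _) _ => //.
  apply: le_trans (le_sum _ (fun i => \sum_j (`|w k i j x0| + 1)) i _) _.
    by move=> *; exact: sumr_ge0.
  apply: (le_sum _ (fun k => \sum_i \sum_j (`|w k i j x0| + 1))).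
  by move=> *; apply: sumr_ge0 => *; exact: sumr_ge0.
have C0 : 0 <= C by apply: le_trans (leC 0 0 0); rewrite addr_ge0.
have near_w : \forall x \near x0, forall k i j, `|w k i j x| <= C.
  apply: (@filter_forall _ _ (fun k x => forall i j, `|w k i j x| <= C) (nbhs x0) _) => k.
  apply: (@filter_forall _ _ (fun i x => forall j, `|w k i j x| <= C) (nbhs x0) _) => i.
  apply: (@filter_forall _ _ (fun j x => `|w k i j x| <= C) (nbhs x0) _) => j.
  have /cvgrPdist_lt/(_ 1 ltr01) H := cw k i j.
  apply: filterS H => x Hx; apply: le_trans (leC k i j).
  rewrite -lerBlDl; apply: le_trans (lerB_dist _ _) _; rewrite distrC; exact: ltW.
have : \forall x \near x0, O x /\ (forall k i j, `|w k i j x| <= C).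
  by apply: filterI => //; exact: open_nbhs_nbhs.
move=> /nbhs_ballP[r /= r0 Hr].
apply/nbhs_ballP; exists r => //= x xr.
pose h := x - x0.
have hr : `|h| < r by move: xr; rewrite -ball_normE /= distrC.
have line (t : R) : 0 <= t <= 1 -> ball x0 r (x0 + t *: h).
  move=> /andP[t0 t1]; rewrite -ball_normE /= opprD addrA subrr add0r normrN normrZ.
  by apply: le_lt_trans hr; rewrite ger0_norm // ler_piMl.
have hk k : `|h 0 k| <= r.
  apply: le_trans (ltW hr); rewrite [leRHS]/Num.Def.normr /= mx_normrE.
  exact: (le_bigmax _ (fun i : 'I_1 * 'I_3 => `|h i.1 i.2|) (0, k)).
pose F (t : R) := \sum_j f j (x0 + t *: h) * f j (x0 + t *: h).
pose dF (t : R) := \sum_j 2 * f j (x0 + t *: h) * 'D_h (f j : E -> R^o) (x0 + t *: h).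
have isdF (t : R) : 0 <= t <= 1 -> is_derive t 1 F (dF t).
  move=> t01; have [Ot _] := Hr _ (line t t01).
  rewrite /dF sum2.
  have D j := derive_line (df j _ Ot).
  have H j : is_derive t 1 (fun s => f j (x0 + s *: h) * f j (x0 + s *: h))
    (2 * f j (x0 + t *: h) * 'D_h (f j : E -> R^o) (x0 + t *: h)).
    apply: is_derive_eq (is_deriveM (D j) (D j)) _.
    by rewrite /GRing.scale /=; ring.
  have -> : F = (fun s : R => f 0 (x0 + s *: h) * f 0 (x0 + s *: h)) +
      (fun s : R => f 1 (x0 + s *: h) * f 1 (x0 + s *: h)).
    by apply/funext => s; rewrite /F sum2.
  exact: is_deriveD.
have F_ge0 t : 0 <= F t by apply: sumr_ge0 => j _; rewrite -expr2 sqr_ge0.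
have ffF i j t : `|f i (x0 + t *: h)| * `|f j (x0 + t *: h)| <= F t.
  have sq k : `|f k (x0 + t *: h)| ^+ 2 <= F t.
    rewrite real_normK ?num_real // expr2 /F (bigD1 k) //= lerDl.
    by apply: sumr_ge0 => m _; rewrite -expr2 sqr_ge0.
  by move: (sq i) (sq j) (sqr_ge0 (`|f i (x0 + t *: h)| - `|f j (x0 + t *: h)|));
    rewrite sqrrB; lra.
(* Each term of the expanded derivative is at most [2 r C F], from [|h_k| <= r], [|w| <= C] and
   [|f_i f_j| <= F]. The constant is kept as a sum so that the comparison can be made term by
   term. *)
pose K := \sum_(j < 2) \sum_(k < 3) \sum_(i < 2) (2 * r * C).
have ledF t : 0 <= t <= 1 -> dF t <= K * F t.
  move=> t01; have [Ot wC] := Hr _ (line t t01).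
  rewrite /dF /K mulr_suml; apply: ler_sum => j _.
  rewrite derive_partials; last exact: df.
  rewrite mulr_sumr mulr_suml; apply: ler_sum => k _.
  rewrite eqf // [leRHS]mulr_suml 2!mulr_sumr; apply: ler_sum => i _.
  apply: le_trans (ler_norm _) _; rewrite !normrM ger0_norm //.
  have -> : 2 * `|f j (x0 + t *: h)| * (`|h 0 k| *
      (`|f i (x0 + t *: h)| * `|w k i j (x0 + t *: h)|)) =
    2 * (`|h 0 k| * `|w k i j (x0 + t *: h)|) *
      (`|f i (x0 + t *: h)| * `|f j (x0 + t *: h)|) by ring.
  apply: ler_pM; [by rewrite ?mulr_ge0|by rewrite ?mulr_ge0| |exact: ffF].
  by rewrite -mulrA ler_pM2l // ler_pM.
have F1 : F 1 <= 0.
  apply: (@gronwall_zero F K) => [t t01|t t01|].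
  - by have [] := isdF t t01.
  - by have [_ ->] := isdF t t01; exact: ledF.
  - by rewrite /F scale0r addr0 big1 // => j _; rewrite f0 mul0r.
have xE : x0 + 1 *: h = x by rewrite scale1r addrC subrK.
move=> j; have := ffF j j 1; rewrite xE => /le_trans/(_ F1).
by rewrite -expr2 exprn_even_le0 //= normr_eq0 => /eqP.
Qed.

End LinearODE.

(** * Zeros of a parallel section *)

Section ParallelSections.
Variables (R : realType) (M : topologicalType) (at_ : smooth_atlas R M).
Variables (S : vector_bundle at_ 2) (nablaS : spinor_cov S).
Hypothesis connS : is_connection at_ (F := fun p => S p) (smooth_sec (S := S)) nablaS.
Local Notation smooth_fun := (smooth_fun at_).
Local Notation smooth_vf := (smooth_vf at_).
Local Notation mfd_diff := (mfd_diff at_).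

Lemma smooth_sec_sub (U V : set M) (s : forall p, S p) :
  V `<=` U -> smooth_sec U s -> smooth_sec V s.
Proof.
by move=> VU H a i; apply: smooth_fun_sub (H a i) => p [/VU].
Qed.

Lemma smooth_secD (U : set M) (s t : forall p, S p) : open U ->
  smooth_sec U s -> smooth_sec U t -> smooth_sec U (fun p => s p + t p).
Proof.
move=> oU Hs Ht a i.
have oI : open (U `&` triv_dom a) by apply: openI => //; exact: open_triv_dom.
apply: smooth_fun_eq oI _ (smooth_funD oI (Hs a i) (Ht a i)) => p _.
by rewrite linearD.
Qed.

Lemma smooth_secZ (U : set M) f (s : forall p, S p) : open U ->
  smooth_fun U f -> smooth_sec U s -> smooth_sec U (fun p => f p *: s p).
Proof.
move=> oU Hf Hs a i.
have oI : open (U `&` triv_dom a) by apply: openI => //; exact: open_triv_dom.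
apply: smooth_fun_eq oI _ (smooth_funM oI
  (smooth_fun_sub (@subIsetl _ _ _) Hf) (Hs a i)) => p _.
by rewrite linearZ.
Qed.

(* A connection only sees a section near the point: multiply by the indicator
   function of [U], which is smooth on [U] and has zero differential there. *)
Lemma connection_local (U : set M) p v (s t : forall q, S q) : open U -> U p ->
  smooth_sec U s -> smooth_sec U t -> (forall q, U q -> s q = t q) ->
  nablaS p v s = nablaS p v t.
Proof.
move=> oU Up Hs Ht st; case: connS => _ _ leibniz _.
pose h q : R := if pselect (U q) then 1 else 0.
have h1 q : U q -> h q = 1 by rewrite /h; case: pselect.
have Hh : smooth_fun U h.
  by apply: smooth_fun_eq oU _ (smooth_fun_cst U 1) => q /h1.
have cut r : smooth_sec U r -> nablaS p v (fun q => h q *: r q) = nablaS p v r.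
  move=> Hr; rewrite (leibniz _ _ _ _ _ oU Up Hh Hr) h1 // scale1r.
  by rewrite (mfd_diff_eq at_ oU Up v h1) mfd_diff_cst scale0r add0r.
rewrite -(cut s Hs) -(cut t Ht); congr (nablaS p v).
apply: functional_extensionality_dep => q; rewrite /h.
by case: pselect => Uq /=; [rewrite (st q Uq)|rewrite !scale0r].
Qed.

Definition frame_sec (a : triv S) (i : 'I_2) : forall p, S p :=
  fun p => tnth (frame a p) i.

Lemma smooth_frame_sec a i : smooth_sec (triv_dom a) (frame_sec a i).
Proof. by move=> b j; rewrite setIC; exact: frame_transition. Qed.

Lemma frame_sec_expand a p (x : S p) : triv_dom a p ->
  x = \sum_i coord (frame a p) i x *: frame_sec a i p.
Proof.
move=> ap; have B := frame_basis ap.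
rewrite {1}(coord_basis B (memvf x)); apply: eq_bigr => i _.
by rewrite /frame_sec (tnth_nth 0).
Qed.

Lemma coord_frame_sec a p i j : triv_dom a p ->
  coord (frame a p) i (frame_sec a j p) = (i == j)%:R.
Proof.
move=> ap; rewrite /frame_sec (tnth_nth 0) coord_free 1?eq_sym //.
exact: basis_free (frame_basis ap).
Qed.

Variables (A : forall p, 'rV[R]_3 -> 'End(S p)) (eps : forall p, S p).
Hypotheses (endoA : endo_form A) (smooth_eps : smooth_sec setT eps)
  (parallel_eps : forall p w, nablaS p w eps = A p w (eps p)).

(** This is the Leibniz rule for the expansion of [eps] in a local frame. The expansion is valid
    only where the frame is, so [connection_local] is what allows it to replace [eps] under the
    derivative. *)
Lemma parallel_coord a j p w : triv_dom a p ->
  mfd_diff (fun q => coord (frame a q) j (eps q)) p w =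
  \sum_i coord (frame a p) i (eps p) *
    coord (frame a p) j (A p w (frame_sec a i p) - nablaS p w (frame_sec a i)).
Proof.
move=> ap; have oa := open_triv_dom a; case: connS => _ addN leibniz _.
pose f i q := coord (frame a q) i (eps q).
have Hf i : smooth_fun (triv_dom a) (f i).
  by have := smooth_eps a i; rewrite setTI.
have He i : smooth_sec (triv_dom a) (fun q => f i q *: frame_sec a i q).
  by apply: smooth_secZ => //; exact: smooth_frame_sec.
have nablaE : nablaS p w eps = \sum_i (mfd_diff (f i) p w *: frame_sec a i p +
    f i p *: nablaS p w (frame_sec a i)).
  rewrite (connection_local w oa ap (t := fun q => f 0 q *: frame_sec a 0 q +
    f 1 q *: frame_sec a 1 q)).
  - rewrite (addN _ _ _ _ _ oa ap (He 0) (He 1)) sum2.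
    by rewrite !(leibniz _ _ _ _ _ oa ap (Hf _) (@smooth_frame_sec a _)).
  - exact: smooth_sec_sub smooth_eps.
  - exact: smooth_secD.
  - by move=> q aq; rewrite {1}(frame_sec_expand (eps q) aq) sum2.
have := parallel_eps p w; rewrite {1}nablaE {1}(frame_sec_expand (eps p) ap).
rewrite linear_sum big_split /= => /esym/eqP; rewrite -subr_eq => /eqP H.
have := congr1 (coord (frame a p) j) H.
rewrite linearB !linear_sum /= => H2.
have -> : mfd_diff (f j) p w =
    \sum_i coord (frame a p) j (mfd_diff (f i) p w *: frame_sec a i p).
  rewrite (bigD1 j) //= linearZ /= coord_frame_sec // eqxx big1.
    by rewrite addr0 /GRing.scale /= mulr1.
  move=> i ij; rewrite linearZ /= coord_frame_sec //.
  by rewrite eq_sym (negbTE ij) /GRing.scale /= mulr0.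
rewrite -H2 -big_split; apply: eq_bigr => i _.
by rewrite /= !linearZ /= linearB /= /GRing.scale /= mulrBr mulrN.
Qed.

(** Along the coordinate fields of one chart, [parallel_coord] becomes a linear system for the
    coordinates of [eps], with smooth coefficients, and [linear_system_zero] applies to it. *)
Lemma parallel_zero_open p0 : eps p0 = 0 -> \forall q \near p0, eps q = 0.
Proof.
move=> eps0; have [a ap] := triv_cover S p0.
pose c := chart_at at_ p0; have cp : chart_dom c p0 := chart_at_dom at_ p0.
pose W := triv_dom a `&` chart_dom c.
have oW : open W by apply: openI; [exact: open_triv_dom|exact: open_chart_dom].
have Wp : W p0 by split.
pose f j q := coord (frame a q) j (eps q).
have Hf j : smooth_fun W (f j).
  have := smooth_eps a j; rewrite setTI; apply: smooth_fun_sub.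
  exact: subIsetl.
pose w k i j q := coord (frame a q) j (A q (coord_vf c k q) (frame_sec a i q) -
  nablaS q (coord_vf c k q) (frame_sec a i)).
have Hw k i j : smooth_fun W (w k i j).
  have sv : smooth_vf W (coord_vf c k) :=
    smooth_vf_sub (@subIsetr _ _ _) (smooth_coord_vf c k).
  have se : smooth_sec W (frame_sec a i) :=
    smooth_sec_sub (@subIsetl _ _ _) (@smooth_frame_sec a i).
  have H1 := endoA.2 _ _ _ oW sv se.
  case: connS => _ _ _ sN; have H2 := sN _ _ _ oW sv se.
  have WE : W `&` triv_dom a = W by rewrite /W setIAC setIid.
  have H4 := H1 a j; have H5 := H2 a j; rewrite WE in H4 H5.
  apply: smooth_fun_eq oW _ (smooth_funB oW H4 H5) => q _.
  by rewrite /w linearB.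
pose x0 := chart_map c p0.
have oO := @open_chart_imageI _ _ _ c _ oW.
have WcE q : W q -> chart_dom c q by case.
have H : \forall x \near x0, forall j, (f j \o chart_inv c) x = 0.
  apply: (linear_system_zero oO (w := fun k i j => w k i j \o chart_inv c)).
  - by exists p0.
  - move=> j _ [q [Wq cq] <-]; exact: smooth_fun_diff (Hf j) Wq cq.
  - move=> k i j; apply/differentiable_continuous.
    exact: smooth_fun_diff (Hw k i j) Wp cp.
  - move=> k j _ [q [Wq cq] <-].
    rewrite -(mfd_diff_coord_vf k oW Wq cq (Hf j)) parallel_coord; last by case: Wq.
    by apply: eq_bigr => i _; rewrite /= chart_mapK.
  - by move=> j; rewrite /= chart_mapK // /f eps0 linear0.
have H2 : \forall q \near p0, forall j, (f j \o chart_inv c) (chart_map c q) = 0.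
  exact: (continuous_chart_map cp) H.
apply: filterS2 H2 (open_nbhs_nbhs (conj oW Wp)) => q Hq [aq cq].
rewrite (frame_sec_expand (eps q) aq) big1 // => i _.
by have := Hq i; rewrite /= chart_mapK // /f => ->; rewrite scale0r.
Qed.

Lemma parallel_nonzero_open p0 : eps p0 <> 0 -> \forall q \near p0, eps q <> 0.
Proof.
move=> eps0; have [a ap] := triv_cover S p0.
have [j fj] : exists j, coord (frame a p0) j (eps p0) != 0.
  apply: contrapT => /forallNP H; apply: eps0.
  rewrite (frame_sec_expand (eps p0) ap) big1 // => i _.
  by have /negP/negPn/eqP -> := H i; rewrite scale0r.
have Hf : smooth_fun (triv_dom a) (fun q => coord (frame a q) j (eps q)).
  by have := smooth_eps a j; rewrite setTI.
have cf := smooth_fun_continuous (open_triv_dom a) Hf ap.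
have n0 : nbhs (coord (frame a p0) j (eps p0)) [set x | x != 0].
  by apply: open_nbhs_nbhs; split => //; exact: open_neq.
have H : nbhs p0 [set q | coord (frame a q) j (eps q) != 0] := cf _ n0.
apply: filterS H => q /= Hq eps0q.
by move: Hq; rewrite eps0q linear0 eqxx.
Qed.

Lemma parallel_nowhere_zero : connected [set: M] -> (exists p, eps p <> 0) ->
  forall p, eps p <> 0.
Proof.
move=> conn [p1 e1] p0 e0; apply: e1.
pose Z := [set p | eps p = 0].
suff ZT : Z = setT by have : Z p1 by rewrite ZT.
apply: conn; first by exists p0.
- exists Z; last by rewrite setTI.
  by rewrite openE => q /parallel_zero_open.
- exists Z; last by rewrite setTI.
  rewrite -[Z]setCK; apply: open_closedC; rewrite openE => q /parallel_nonzero_open.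
  exact.
Qed.

End ParallelSections.

(** * The square of a spinor and its recurrence *)

Section SpinorSquare.
Variables (R : realType) (M : topologicalType) (at_ : smooth_atlas R M).
Variables (g : M -> 'M[R]_3) (o : M -> bool) (T : M -> 'rV[R]_3).
Hypotheses (lorentzian_g : lorentzian at_ g) (spinM : spin_manifold at_ g o T).
Variables (l : R) (S : vector_bundle at_ 2) (Gam : forall p, 'cV[R]_3 -> 'End(S p)).
Unset Implicit Arguments.
Variable B : forall p, S p -> S p -> R.
Hypotheses (l2 : l * l = 1) (paired : paired_spinor_bundle g o l Gam B).
Let symg := metric_trmx lorentzian_g.
Let unitg := metric_unitmx spinM.

Lemma Gam_linear p k a b : Gam p (k *: a + b) = k *: Gam p a + Gam p b.
Proof. by case: paired => -[H _ _ _ _] _; exact: H. Qed.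

Lemma Gam0 p : Gam p 0 = 0.
Proof.
have := Gam_linear p (-1) 0 0; rewrite scaler0 addr0 => ->.
by rewrite scaleN1r addNr.
Qed.

Lemma Gam_sum p a : Gam p a = \sum_i a i 0 *: Gam p (delta_mx i 0).
Proof.
have aE : a = a 0 0 *: delta_mx 0 0 + a 1 0 *: delta_mx 1 0 + a 2 0 *: delta_mx 2 0.
  by rewrite {1}(matrix_sum_delta a) sum3 !big_ord1.
have D x y : Gam p (x + y) = Gam p x + Gam p y.
  by rewrite -[x]scale1r Gam_linear !scale1r.
have Z k x : Gam p (k *: x) = k *: Gam p x.
  by rewrite -[k *: x]addr0 Gam_linear Gam0 addr0.
by rewrite {1}aE !D !Z sum3.
Qed.

Lemma B_linear_l p k x y z : B p (k *: x + y) z = k * B p x z + B p y z.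
Proof. by case: paired => _ [H _ _ _ _]; exact: H. Qed.

Lemma B_skew p x y : B p x y = - B p y x.
Proof. by case: paired => _ [_ H _ _ _]; exact: H. Qed.

Lemma B_alt p x : B p x x = 0.
Proof. by have := B_skew p x x; lra. Qed.

Lemma B_linear_r p k x y z : B p z (k *: x + y) = k * B p z x + B p z y.
Proof. by rewrite B_skew B_linear_l (B_skew p z x) (B_skew p z y); ring. Qed.

Lemma B0_l p z : B p 0 z = 0.
Proof. by have := B_linear_l p (-1) 0 0 z; rewrite scaler0 addr0; lra. Qed.

Lemma B_scale_l p k x z : B p (k *: x) z = k * B p x z.
Proof. by rewrite -[k *: x]addr0 B_linear_l B0_l addr0. Qed.

Lemma B_scale_r p k x z : B p z (k *: x) = k * B p z x.
Proof. by rewrite B_skew B_scale_l (B_skew p z x) mulrN. Qed.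

Lemma B_Gam p a x y : B p (Gam p a x) y = - B p x (Gam p a y).
Proof. by case: paired => _ [_ _ _ _ H]; exact: H. Qed.

Set Implicit Arguments.

(** In any basis of the fibre, [B] is a multiple [b] of the area form, so its skewness makes every
    Clifford matrix traceless. The three remaining entries are linear in the one-form, hence are its
    values on three vectors; the factors [2^-1] and [l] undo those in [clifford_mx]. The Clifford
    relation and the action of the volume element then make these vectors a null frame. *)
Lemma spinor_normal_form p : exists (sg : S p -> 'rV[R]_2) (b : R) (K U n : 'rV[R]_3),
  [/\ null_frame (g p) (o p) K U n, b != 0 /\ forall s, sg s = 0 -> s = 0,
      forall a s, sg (Gam p a s) = sg s *m clifford_mx l K U n a &
      forall s t, B p s t = b * (sg s 0 0 * sg t 0 1 - sg s 0 1 * sg t 0 0)].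
Proof.
have [a ap] := triv_cover S p.
pose X := frame a p; pose e i := frame_sec a i p.
pose x i s := coord X i s.
have expand s : s = x 0 s *: e 0 + x 1 s *: e 1.
  by rewrite {1}(frame_sec_expand s ap) sum2.
have xD i k s t : x i (k *: s + t) = k * x i s + x i t.
  by rewrite /x linearD linearZ.
have xe i j : x i (e j) = (i == j)%:R by exact: coord_frame_sec.
have [b BE] : exists b, forall s t, B p s t = b * (x 0 s * x 1 t - x 1 s * x 0 t).
  exists (B p (e 0) (e 1)) => s t; rewrite {1}(expand s) {1}(expand t).
  by rewrite B_linear_l B_scale_l !B_linear_r !B_scale_r !B_alt (B_skew p (e 1)); ring.
have b0 : b != 0.
  apply/eqP => b0; case: paired => _ [_ _ nd _ _].
  have e00 : e 0 = 0 by apply: nd => y; rewrite BE b0 mul0r.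
  by have := xe 0 0; rewrite e00 /x linear0 => /eqP; rewrite eq_sym oner_eq0.
pose m i j c := x i (Gam p c (e j)).
have trace0 c : m 1 1 c = - m 0 0 c.
  have := B_Gam p c (e 0) (e 1); rewrite !BE !xe /= mulr1 mulr0 subr0 mul1r mul0r subr0.
  by rewrite -mulrN => /(mulfI b0) E1; rewrite /m E1 opprK.
have msum i j c : m i j c = \sum_k c k 0 * m i j (delta_mx k 0).
  rewrite /m /x Gam_sum !sum3 !add_lfunE !scale_lfunE.
  by rewrite !linearD !linearZ.
pose K : 'rV[R]_3 := \row_k (2^-1 * m 0 1 (delta_mx k 0)).
pose U : 'rV[R]_3 := \row_k m 1 0 (delta_mx k 0).
pose n : 'rV[R]_3 := \row_k (l * m 0 0 (delta_mx k 0)).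
have evn c : l * ev c n = m 0 0 c.
  by rewrite evE !mxE (msum 0 0 c) sum3 -[RHS]mul1r -l2; ring.
have evU c : ev c U = m 1 0 c.
  by rewrite evE !mxE (msum 1 0 c) sum3; ring.
have evK c : 2 * ev c K = m 0 1 c.
  by rewrite evE !mxE (msum 0 1 c) sum3; field.
pose sg s : 'rV[R]_2 := \row_i x i s.
have sgGam c s : sg (Gam p c s) = sg s *m clifford_mx l K U n c.
  have E1 i : x i (Gam p c s) = x 0 s * m i 0 c + x 1 s * m i 1 c.
    by rewrite {1}(expand s) linearD !linearZ /x linearD !linearZ.
  apply: rV2P; rewrite !mxE sum2 !mxE /= E1 ?evn ?evU ?evK //.
  by rewrite trace0.
have sginj s t : sg s = sg t -> s = t.
  move=> /rowP st; rewrite (expand s) (expand t).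
  by have := st 0; have := st 1; rewrite !mxE => -> ->.
exists sg, b, K, U, n; split.
- have [f orth pos] := frame_at spinM p.
  have l0 : l != 0 by apply: contra_eq_neq l2 => ->; rewrite mul0r eq_sym oner_neq0.
  apply: (clifford_null_frame (symg p) orth pos l0).
    move=> c; case: paired => -[_ _ sq _ _] _.
    have := congr1 (fun F : 'End(S p) => x 0 (F (e 0))) (sq p c).
    rewrite comp_lfunE scale_lfunE id_lfunE.
    have E1 : x 0 (cometric (g p) c c *: e 0) = cometric (g p) c c.
      by rewrite /x linearZ /= -/(x 0 (e 0)) xe mulr1.
    have E2 : x 0 (Gam p c (Gam p c (e 0))) =
        sg (Gam p c (Gam p c (e 0))) 0 0 by rewrite mxE.
    rewrite E1 E2 !sgGam => <-.
    rewrite !mxE !sum2 !mxE !sum2 !mxE !xe /=.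
    have := congr1 ( *%R^~ (ev c n * ev c n)) l2; rewrite /= mul1r; lra.
  move=> E orthE posE; case: paired => -[_ _ _ _ orient] _.
  have := orient p E orthE posE => H.
  have Hj j : delta_mx 0 j *m (clifford_mx l K U n (col 2 E) *m
      clifford_mx l K U n (col 1 E) *m clifford_mx l K U n (col 0 E)) =
      (l *: delta_mx 0 j : 'rV[R]_2).
    have sgj : sg (e j) = delta_mx 0 j by apply/rowP => i; rewrite !mxE xe.
    have sgZ : sg (l *: e j) = l *: sg (e j).
      by apply/rowP => i; rewrite !mxE /x linearZ.
    rewrite -sgj !mulmxA -!sgGam -sgZ; congr sg.
    by have := congr1 (fun F : 'End(S p) => F (e j)) H;
      rewrite !comp_lfunE scale_lfunE id_lfunE.
  apply/row_matrixP => j; rewrite !rowE Hj.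
  by rewrite -mul_mx_scalar.
- split=> // s /rowP s0; rewrite (expand s).
  by have := s0 0; have := s0 1; rewrite !mxE => -> ->; rewrite !scale0r addr0.
- exact: sgGam.
- by move=> s t; rewrite BE !mxE.
Qed.

Definition spinor_square (p : M) (s : S p) : 'cV[R]_3 :=
  \col_i B p (Gam p (flat (g p) (delta_mx 0 i)) s) s.

Lemma ev_spinor_square p s v :
  ev (spinor_square s) v = B p (Gam p (flat (g p) v) s) s.
Proof.
have flatL k x y : flat (g p) (k *: x + y) = k *: flat (g p) x + flat (g p) y.
  by rewrite /flat linearP mulmxDr scalemxAr.
have L k x y : B p (Gam p (flat (g p) (k *: x + y)) s) s =
    k * B p (Gam p (flat (g p) x) s) s + B p (Gam p (flat (g p) y) s) s.
  by rewrite flatL Gam_linear add_lfunE scale_lfunE B_linear_l.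
have vE : v = v 0 0 *: delta_mx 0 0 + (v 0 1 *: delta_mx 0 1 + v 0 2 *: delta_mx 0 2).
  by rewrite {1}(row_sum_delta v) sum3 addrA.
have Z k x : B p (Gam p (flat (g p) (k *: x)) s) s = k * B p (Gam p (flat (g p) x) s) s.
  have Z0 : B p (Gam p (flat (g p) 0) s) s = 0.
    by rewrite /flat trmx0 mulmx0 Gam0 zero_lfunE B0_l.
  by rewrite -[k *: x]addr0 L Z0 addr0.
by rewrite [in RHS]vE L L Z evE !mxE addrA.
Qed.

(** For coordinates [(x, y)] of [s], the values on [K], [U], [n] are [- b x^2], [2 b y^2] and
    [2 b l x y]. They satisfy the null relation because [l * l = 1], and the first two vanish
    together only for [x = y = 0]. *)
Lemma spinor_square_null p (s : S p) :
  cometric (g p) (spinor_square s) (spinor_square s) = 0 /\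
  (s <> 0 -> spinor_square s <> 0).
Proof.
have [sg [b [K [U [n [nf [b0 sg0] sgGam BE]]]]]] := spinor_normal_form p.
have [KK UU nn KU Kn Un _] := nf.
have val v : ev (spinor_square s) v = b * (2 * l * sg s 0 0 * sg s 0 1 * bil (g p) v n
    + 2 * (sg s 0 1 * sg s 0 1) * bil (g p) v K - sg s 0 0 * sg s 0 0 * bil (g p) v U).
  by rewrite ev_spinor_square BE sgGam !mxE !sum2 !mxE /= !(ev_flat (symg p)); ring.
have vU : ev (spinor_square s) U = 2 * b * (sg s 0 1 * sg s 0 1).
  by rewrite val UU Un (bilC (symg p)) KU; ring.
have vK : ev (spinor_square s) K = - (b * (sg s 0 0 * sg s 0 0)).
  by rewrite val KU KK Kn; ring.
have vn : ev (spinor_square s) n = 2 * b * l * (sg s 0 0 * sg s 0 1).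
  by rewrite val nn (bilC (symg p) n) Kn (bilC (symg p) n) Un; ring.
split.
  rewrite (null_frame_cometric (symg p) (unitg p) nf) vU vK vn.
  move: (sg s 0 0) (sg s 0 1) => x y.
  have -> : 2 * b * l * (x * y) * (2 * b * l * (x * y)) =
    l * l * (4 * (b * (x * y)) * (b * (x * y))) by ring.
  by rewrite l2; ring.
move=> s0 sq0; apply: s0; apply: sg0.
have sq v : ev (spinor_square s) v = 0 by rewrite sq0 evE !mxE; ring.
have two : 2 != 0 :> R by rewrite pnatr_eq0.
apply: rV2P; rewrite mxE.
  by move/eqP: vK; rewrite sq eq_sym oppr_eq0 !mulf_eq0 (negbTE b0) /= orbb => /eqP.
by move/eqP: vU; rewrite sq eq_sym !mulf_eq0 (negbTE b0) (negbTE two) /= orbb => /eqP.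
Qed.

(** Skewness turns the left side into [B(s, Gamma(a) Gamma(y^b) s)]. In the product formula the
    scalar part contributes a multiple of [B(s, s) = 0], and the rest is [l] times the square of [s]
    evaluated on the star. With [a = chi_w] this is the contorsion term. *)
Lemma pairing_clifford p (s : S p) a y :
  B p (Gam p (flat (g p) y) s) (Gam p a s) =
  l * vol (g p) (o p) (sharp (g p) a) y (sharp (g p) (spinor_square s)).
Proof.
have [sg [b [K [U [n [nf _ sgGam BE]]]]]] := spinor_normal_form p.
pose h := hodge_product (g p) (o p) a (flat (g p) y).
have -> : vol (g p) (o p) (sharp (g p) a) y (sharp (g p) (spinor_square s)) =
    B p (Gam p h s) s.
  rewrite -{1}(flatK (unitg p) y) -(ev_hodge (o p) (symg p) (unitg p)) -/h.
  rewrite -(bil_sharp (symg p) (unitg p)) (bilC (symg p)) (bil_sharp (symg p) (unitg p)).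
  by rewrite ev_spinor_square (sharpK (unitg p)).
rewrite B_skew B_Gam opprK !BE !sgGam -mulmxA.
rewrite (clifford_mx_mul (symg p) (unitg p) nf _ _ l2) -/h.
rewrite mulmxBr -scalemxAr mul_mx_scalar.
move: (sg s *m clifford_mx l K U n h) (cometric _ _ _) => z q.
by rewrite !mxE; ring.
Qed.

Variables (theta : M -> 'cV[R]_3) (chi : M -> 'M[R]_3).
Variables (nablag D : tangent_cov R M) (nablaS : spinor_cov S)
  (A : forall p, 'rV[R]_3 -> 'End(S p)) (eps : forall p, S p).
Hypotheses (contorsion_D : has_contorsion at_ nablag D (contorsion g o l chi))
  (lift : spin_lift g nablag Gam B nablaS)
  (dequant : has_dequantization Gam A (half_sum theta chi))
  (diff_eps : differential_spinor nablaS A eps).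

Lemma smooth_flat W X : open W -> smooth_vf at_ W X ->
  smooth_form at_ W (fun p => flat (g p) (X p)).
Proof.
move=> oW HX V Y oV HY.
have oI : open (W `&` V) by exact: openI.
have Hb := smooth_bil lorentzian_g oI (smooth_vf_sub (@subIsetl _ _ _) HX)
  (smooth_vf_sub (@subIsetr _ _ _) HY).
by apply: smooth_fun_eq oI _ Hb => p _; rewrite (ev_flat (symg p)).
Qed.

Lemma smooth_Gam_eps W X : open W -> smooth_vf at_ W X ->
  smooth_sec W (fun p => Gam p (flat (g p) (X p)) (eps p)).
Proof.
move=> oW HX; case: paired => -[_ H _ _ _] _; apply: (H _ _ _ oW (smooth_flat oW HX)).
exact: smooth_sec_sub (@subsetT _ _) diff_eps.1.
Qed.

Lemma smooth_spinor_square : smooth_form at_ setT (fun p => spinor_square (eps p)).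
Proof.
move=> V X oV HX; rewrite setTI; case: paired => _ [_ _ _ H _].
have Hb := H _ _ _ oV (smooth_Gam_eps oV HX)
  (smooth_sec_sub (@subsetT _ _) diff_eps.1).
by apply: smooth_fun_eq oV _ Hb => p _; rewrite ev_spinor_square.
Qed.

(** Differentiating [B(Gamma(Y^b) eps, eps)] produces the term of [nabla Y] and two equal terms
    [B(Gamma(Y^b) eps, A_w eps)]. Their [theta] halves add up to [theta(w) u(Y)], and their [chi]
    halves cancel the contorsion of [D] by [pairing_clifford]. *)
Lemma spinor_square_recurrent :
  recurrent_form at_ D theta (fun p => spinor_square (eps p)).
Proof.
move=> W p w Y oW Wp HY; case: lift => _ liftG liftB.
have Heps : smooth_sec W eps := smooth_sec_sub (@subsetT _ _) diff_eps.1.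
rewrite (mfd_diff_eq at_ oW Wp w (g := fun q =>
  B q (Gam q (flat (g q) (Y q)) (eps q)) (eps q))); last first.
  by move=> q _; rewrite ev_spinor_square.
rewrite (liftB _ _ _ _ _ oW Wp (smooth_Gam_eps oW HY) Heps).
rewrite (liftG _ _ _ _ _ oW Wp HY Heps) diff_eps.2 -dequant.
rewrite (@contorsion_D W p w Y oW Wp HY).
have sqE v : ev (spinor_square (eps p)) v =
    bil (g p) (sharp (g p) (spinor_square (eps p))) v.
  by rewrite (bil_sharp (symg p) (unitg p)).
rewrite [X in _ - X]sqE bil_addr (bil_contorsion lorentzian_g spinM) -sqE.
rewrite -pairing_clifford !ev_spinor_square.
rewrite /quantization /half_sum /= add_lfunE scale_lfunE id_lfunE.
have -> : Gam p (2^-1 *: first_entry chi p w) = 2^-1 *: Gam p (first_entry chi p w).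
  by rewrite -[2^-1 *: first_entry _ _ _]addr0 Gam_linear Gam0 addr0.
rewrite scale_lfunE.
set e := eps p; set c := flat (g p) (Y p); set f := first_entry chi p w.
set c' := flat (g p) _; set th := ev (theta p) w.
rewrite -[Gam p c' e]scale1r B_linear_l (B_Gam p c (_ + _)) -B_skew.
rewrite B_linear_r B_scale_r B_scale_l; lra.
Qed.

End SpinorSquare.

(** * The equivalence, by passing between isotropic one-forms and null vector fields *)

Unset Implicit Arguments.

Theorem theorem3p9 (R : realType)
    (M : topologicalType) (at_ : smooth_atlas R M)
    (hausdorffM : hausdorff_space M) (countableM : @second_countable M)
    (nonemptyM : [set: M] !=set0) (connectedM : connected [set: M])
    (g : M -> 'M[R]_3) (lorentzian_g : lorentzian at_ g)
    (o : M -> bool) (orientation_o : orientation at_ o)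
    (T : M -> 'rV[R]_3) (time_orientation_T : time_orientation at_ g T)
    (spinM : spin_manifold at_ g o T)
    (l : R) (l_sign : l = 1 \/ l = -1)
    (theta : M -> 'cV[R]_3) (smooth_theta : smooth_form at_ setT theta)
    (chi : M -> 'M[R]_3) (smooth_chi : smooth_bilinear at_ chi)
    (nablag : tangent_cov R M) (levi_civita_nablag : levi_civita at_ g nablag)
    (D : tangent_cov R M) (metric_D : metric_connection at_ g D)
    (contorsion_D : has_contorsion at_ nablag D (contorsion g o l chi)) :
  (exists (S : vector_bundle at_ 2)
          (Gam : forall p, 'cV[R]_3 -> 'End(S p))
          (B : forall p, S p -> S p -> R)
          (nablaS : spinor_cov S)
          (A : forall p, 'rV[R]_3 -> 'End(S p))
          (eps : forall p, S p),
     [/\ paired_spinor_bundle g o l Gam B,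
         spin_lift g nablag Gam B nablaS,
         endo_form A /\ has_dequantization Gam A (half_sum theta chi),
         differential_spinor nablaS A eps &
         exists p, eps p <> 0])
  <->
  (exists u : M -> 'cV[R]_3,
     [/\ smooth_form at_ setT u,
         forall p, u p <> 0,
         forall p, cometric (g p) (u p) (u p) = 0 &
         recurrent_form at_ D theta u]).
Proof.
have l2 : l * l = 1 by case: l_sign => ->; ring.
split.
  move=> [S [Gam [B [nablaS [A [eps [paired lift [endoA dequant] diff_eps nz]]]]]]].
  have eps0 : forall p, eps p <> 0.
    case: lift => conn _ _.
    exact: (parallel_nowhere_zero conn endoA diff_eps.1 diff_eps.2 connectedM nz).
  exists (fun p => spinor_square g Gam B (eps p)); split.
  - exact: (smooth_spinor_square lorentzian_g paired diff_eps).
  - by move=> p; apply: (spinor_square_null lorentzian_g spinM l2 paired (eps p)).2.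
  - by move=> p; exact: (spinor_square_null lorentzian_g spinM l2 paired (eps p)).1.
  - exact: (spinor_square_recurrent lorentzian_g spinM l2 paired contorsion_D lift
      dequant diff_eps).
move=> [u [smooth_u u0 null_u recurrent_u]].
have symg := metric_trmx lorentzian_g; have unitg := metric_unitmx spinM.
pose U p := sharp (g p) (u p).
have flatU : (fun p => flat (g p) (U p)) = u.
  by apply/funext => p; rewrite /U sharpK.
have UU p : bil (g p) (U p) (U p) = 0.
  by rewrite /U (bil_sharp (symg p) (unitg p)) -(cometric_sharp (symg p)) null_u.
have U0 p : U p <> 0.
  move=> H; apply: (u0 p); rewrite -[u p](sharpK (unitg p)) -/(U p) H.
  by rewrite /flat trmx0 mulmx0.
have sU : smooth_vf at_ setT U := smooth_sharp lorentzian_g spinM smooth_u.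
have [sT TT] := time_orientation_T.
have TU p : bil (g p) (T p) (U p) != 0.
  have [e orth _] := frame_at spinM p.
  exact: (timelike_null_neq0 (symg p) orth (TT p) (UU p) (U0 p)).
pose K p := null_partner (g p) (T p) (U p).
have sK : smooth_vf at_ setT K := smooth_null_partner lorentzian_g sT sU TU.
pose n p := normal_vec (g p) (o p) (K p) (U p).
have sn : smooth_vf at_ setT n := smooth_normal_vec lorentzian_g spinM sK sU.
have nf p : null_frame (g p) (o p) (K p) (U p) (n p).
  have [e orth pos] := frame_at spinM p.
  exact: (null_frame_construct (symg p) orth pos (TT p) (UU p) (U0 p)).
have recU : recurrent_form at_ D theta (fun p => flat (g p) (U p)) by rewrite flatU.
have [S [Gam [B [nablaS [A [eps [H1 H2 H3 H4 H5]]]]]]] :=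
  recurrent_null_frame_spinor lorentzian_g spinM l2 levi_civita_nablag.1 sK sU sn nf
    smooth_theta smooth_chi contorsion_D recU.
exists S, Gam, B, nablaS, A, eps; split=> //.
by have [p _] := nonemptyM; exists p.
Qed.
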